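(* Let $j,k,m,n,q,s$ be integers with $1\le j\le q$ and $1\le k\le s$ (and $j\le n$, $k\le m$, so that the blocks below are defined). Let $M\in\mathbb R^{m\times n}$ be a fixed matrix, $\mu\in\mathbb R$, $\sigma>0$, $y\ge 0$, and let $G\in\mathcal G_{\mu,\sigma}^{q\times m}$ and $H\in\mathcal G_{\mu,\sigma}^{n\times s}$ be Gaussian random matrices. Suppose that $\operatorname{rank}(M_j)=j$ for $M_j=M\begin{pmatrix}I_j\\ O_{n-j,j}\end{pmatrix}$ and that $\operatorname{rank}(M^{(k)})=k$ for $M^{(k)}=(I_k~|~O_{k,m-k})M$. Then: (i) with probability $1$ the matrix $GM$ (resp. $MH$) has full rank if $\operatorname{rank}(M)\ge q$ (resp. if $\operatorname{rank}(M)\ge s$); (ii) $F_{1/\|((GM)_j^{(j)})^+\|}(y)\le 2.35\,y\sqrt{j}\,\|M_j^+\|/\sigma$ if $\operatorname{rank}(M)\ge j$, and $F_{1/\|((MH)_k^{(k)})^+\|}(y)\le 2.35\,y\sqrt{k}\,\|(M^{(k)})^+\|/\sigma$ if $\operatorname{rank}(M)\ge k$.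
   Context: All matrices are real. $I_k$ is the $k\times k$ identity matrix, $O_{k,l}$ is the $k\times l$ zero matrix, and $(B~|~C)$ denotes the block matrix with blocks $B$ and $C$ side by side. For a matrix $A$, $A_k^{(k)}$ denotes its leading (northwestern) $k\times k$ block submatrix. $\|\cdot\|$ is the spectral norm (matrix 2-norm). $A^+$ is the Moore–Penrose pseudo-inverse of $A$; for a matrix $A$ of rank $\rho\ge1$, $\|A^+\|=1/\sigma_\rho(A)$, where $\sigma_j(A)$ denotes the $j$th largest singular value. For a real random variable $\gamma$, $F_\gamma(y)=\mathrm{Probability}\{\gamma\le y\}$ is its cumulative distribution function. $\mathcal G_{\mu,\sigma}^{p\times q}$ is the set of $p\times q$ Gaussian random matrices whose entries are independent identically distributed Gaussian random variables, all with mean $\mu$ and variance $\sigma^2>0$. An $m\times n$ matrix has full rank if its rank is $\min\{m,n\}$. *)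

(* Defs.v *)
From HB Require Import structures.
From mathcomp Require Import all_boot all_order all_algebra.
From mathcomp Require Import all_classical all_reals all_analysis.
From mathcomp Require Import measurable_realfun.

Set Implicit Arguments.
Unset Strict Implicit.
Unset Printing Implicit Defensive.

Import Order.TTheory GRing.Theory Num.Theory.
Import numFieldNormedType.Exports.

Local Open Scope classical_set_scope.
Local Open Scope ring_scope.

Definition lead_block (T : Type) (k p r : nat) (hp : (k <= p)%N)
    (hr : (k <= r)%N) (A : 'M[T]_(p, r)) : 'M[T]_k :=
  mxsub (widen_ord hp) (widen_ord hr) A.

(* When k <= p (resp. k <= r), pid_mx k is (I_k | O) : 'M_(k, p) (resp.
   the block column (I_k ; O) : 'M_(r, k)). *)
Definition first_rows (R : realType) (k p r : nat) (A : 'M[R]_(p, r)) :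
  'M[R]_(k, r) := (pid_mx k : 'M[R]_(k, p)) *m A.

Definition first_cols (R : realType) (k p r : nat) (A : 'M[R]_(p, r)) :
  'M[R]_(p, k) := A *m (pid_mx k : 'M[R]_(r, k)).

Definition full_rank (F : fieldType) (p r : nat) (A : 'M[F]_(p, r)) : Prop :=
  \rank A = minn p r.

Definition norm2 (R : realType) (p : nat) (x : 'cV[R]_p) : R :=
  Num.sqrt (\sum_(i < p) x i 0 ^+ 2).

Definition spectral_norm (R : realType) (p r : nat) (A : 'M[R]_(p, r)) : R :=
  sup [set norm2 (A *m x) | x in [set x : 'cV[R]_r | norm2 x <= 1]].

(* The four Penrose equations; [mpinvP] and [is_mpinv_unique] below show that they
   have exactly one solution, so the default value in [mpinv] is never used. *)
Definition is_mpinv (R : realType) (p r : nat) (A : 'M[R]_(p, r))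
    (X : 'M[R]_(r, p)) : Prop :=
  [/\ A *m X *m A = A, X *m A *m X = X,
      (A *m X)^T = A *m X & (X *m A)^T = X *m A].

Definition mpinv (R : realType) (p r : nat) (A : 'M[R]_(p, r)) : 'M[R]_(r, p) :=
  xget 0 [set X | is_mpinv A X].

Section pinv_theory.
Context {R : realType}.

Lemma norm2_sqr p (x : 'cV[R]_p) : norm2 x ^+ 2 = \sum_(i < p) x i 0 ^+ 2.
Proof. by rewrite sqr_sqrtr// sumr_ge0// => i _; exact: sqr_ge0. Qed.

Lemma norm2_sqrE p (x : 'cV[R]_p) : norm2 x ^+ 2 = (x^T *m x) 0 0.
Proof. by rewrite norm2_sqr mxE; apply: eq_bigr => i _; rewrite mxE expr2. Qed.

Lemma norm2_ge0 p (x : 'cV[R]_p) : 0 <= norm2 x.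
Proof. exact: sqrtr_ge0. Qed.

Lemma norm2_eq0 p (x : 'cV[R]_p) : norm2 x = 0 -> x = 0.
Proof.
move=> x0; have := norm2_sqr x; rewrite x0 expr0n/= => /esym/eqP.
rewrite psumr_eq0; last by move=> i _; exact: sqr_ge0.
move=> /allP h; apply/matrixP => i j; rewrite ord1 mxE.
by have := h i (mem_index_enum _); rewrite sqrf_eq0 => /eqP.
Qed.

Lemma norm2Z p (a : R) (x : 'cV[R]_p) : norm2 (a *: x) = `|a| * norm2 x.
Proof.
rewrite /norm2 -sqrtr_sqr -sqrtrM ?sqr_ge0// mulr_sumr; congr Num.sqrt.
by apply: eq_bigr => i _; rewrite mxE exprMn.
Qed.

Lemma norm20 p : norm2 (0 : 'cV[R]_p) = 0.
Proof. by rewrite -(scale0r 0) norm2Z normr0 mul0r. Qed.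

Lemma spectral_norm_has_sup p r (A : 'M[R]_(p, r)) :
  has_sup [set norm2 (A *m x) | x in [set x : 'cV[R]_r | norm2 x <= 1]].
Proof.
split; first by exists (norm2 (A *m 0)), 0 => //=; rewrite norm20.
exists (Num.sqrt (\sum_(i < p) (\sum_(j < r) `|A i j|) ^+ 2)).
move=> _ [x /= x1 <-]; apply: ler_wsqrtr; apply: ler_sum => i _.
rewrite -[leLHS]real_normK ?num_real// lerXn2r ?nnegrE ?sumr_ge0//.
rewrite mxE (le_trans (ler_norm_sum _ _ _))//; apply: ler_sum => j _.
rewrite normrM ler_piMr// -(@ler_pXn2r _ 2)// ?nnegrE// expr1n real_normK ?num_real//.
have : norm2 x ^+ 2 <= 1 by rewrite exprn_ile1// norm2_ge0.
apply: le_trans; rewrite norm2_sqr (bigD1 j)//= lerDl sumr_ge0// => k _.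
exact: sqr_ge0.
Qed.

Lemma spectral_norm_ge0 p r (A : 'M[R]_(p, r)) : 0 <= spectral_norm A.
Proof.
apply: le_trans (_ : norm2 (A *m 0) <= _); first exact: norm2_ge0.
apply: sup_upper_bound; first exact: spectral_norm_has_sup.
by exists 0 => //=; rewrite norm20.
Qed.

Lemma spectral_norm_le p r (A : 'M[R]_(p, r)) c : 0 <= c ->
  spectral_norm A <= c <-> forall x, norm2 (A *m x) <= c * norm2 x.
Proof.
move=> c0; split=> [Ac x|Ac].
  have [x0|xn0] := eqVneq (norm2 x) 0.
    by rewrite (norm2_eq0 x0) mulmx0 !norm20 mulr0.
  have xgt0 : 0 < norm2 x by rewrite lt_neqAle eq_sym xn0 norm2_ge0.
  rewrite -ler_pdivrMr// mulrC -[(norm2 x)^-1]ger0_norm ?invr_ge0 ?norm2_ge0//.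
  rewrite -norm2Z scalemxAr; apply: le_trans Ac.
  apply: sup_upper_bound; first exact: spectral_norm_has_sup.
  exists ((norm2 x)^-1 *: x) => //=.
  by rewrite norm2Z ger0_norm ?invr_ge0 ?norm2_ge0// mulVf.
apply: ge_sup; first by case: (spectral_norm_has_sup A).
move=> _ [x /= x1 <-]; apply: le_trans (Ac x) _.
by rewrite ler_piMr.
Qed.

Lemma row_free_gram_unit p r (C : 'M[R]_(p, r)) :
  row_free C -> C *m C^T \in unitmx.
Proof.
move=> Cf; rewrite -row_free_unit; apply: inj_row_free => v v0.
apply: (row_free_inj Cf); rewrite mul0mx; apply: trmx_inj.
rewrite trmx0; apply: norm2_eq0; apply/eqP; rewrite -sqrf_eq0 norm2_sqrE trmxK.
by rewrite trmx_mul !mulmxA -[v *m C *m _]mulmxA v0 mul0mx mxE.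
Qed.

Lemma mpinv_exists p r (A : 'M[R]_(p, r)) : exists X, is_mpinv A X.
Proof.
have [k [B [C [AE Bf Cf]]]] : exists k (B : 'M[R]_(p, k)) (C : 'M[R]_(k, r)),
    [/\ A = B *m C, row_free B^T & row_free C].
  exists (\rank A), (col_base A), (row_base A); split.
  - by rewrite mulmx_base.
  - by rewrite /row_free mxrank_tr; exact: col_base_full.
  - exact: row_base_free.
have uC : C *m C^T \in unitmx by exact: row_free_gram_unit.
have uB : B^T *m B \in unitmx.
  by rewrite -[X in _ *m X]trmxK; exact: row_free_gram_unit.
pose X := C^T *m invmx (C *m C^T) *m invmx (B^T *m B) *m B^T.
have AX : A *m X = B *m invmx (B^T *m B) *m B^T.
  by rewrite AE /X -!mulmxA; congr (_ *m _); rewrite !mulmxA mulmxV// mul1mx.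
have XA : X *m A = C^T *m invmx (C *m C^T) *m C.
  rewrite AE /X -!mulmxA; congr (_ *m (_ *m _)); rewrite !mulmxA.
  by rewrite -[X in X *m C = _]mulmxA mulVmx// mul1mx.
exists X; split.
- rewrite AX AE -!mulmxA; congr (_ *m _).
  by rewrite [B^T *m (B *m C)]mulmxA [invmx _ *m _]mulmxA mulVmx// mul1mx.
- rewrite XA /X -!mulmxA; congr (_ *m (_ *m _)).
  by rewrite [C *m (C^T *m _)]mulmxA [C *m C^T *m _]mulmxA mulmxV// mul1mx.
- by rewrite AX !trmx_mul trmxK trmx_inv trmx_mul trmxK mulmxA.
- by rewrite XA !trmx_mul trmxK trmx_inv trmx_mul trmxK mulmxA.
Qed.

Lemma is_mpinv_unique p r (A : 'M[R]_(p, r)) X Y :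
  is_mpinv A X -> is_mpinv A Y -> X = Y.
Proof.
move=> [AXA XAX AXs XAs] [AYA YAY AYs YAs].
have XE : X = X *m A *m Y.
  have : (A *m Y) *m (A *m X) = A *m X by rewrite !mulmxA AYA.
  move/(congr1 trmx); rewrite trmx_mul AXs AYs mulmxA => h.
  by rewrite -[LHS]XAX -mulmxA -h !mulmxA XAX.
have YE : Y = X *m A *m Y.
  have : (Y *m A) *m (X *m A) = Y *m A by rewrite -!mulmxA [A *m (X *m A)]mulmxA AXA.
  move/(congr1 trmx); rewrite trmx_mul XAs YAs => h.
  by rewrite -[LHS]YAY -h -!mulmxA [Y *m (A *m Y)]mulmxA YAY.
by rewrite XE -YE.
Qed.

Lemma mpinvP p r (A : 'M[R]_(p, r)) : is_mpinv A (mpinv A).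
Proof.
by rewrite /mpinv; case: xgetP => //= h; case: (mpinv_exists A) => X /h.
Qed.

Lemma norm2_proj p (Q : 'M[R]_p) (x : 'cV[R]_p) :
  Q^T = Q -> Q *m Q = Q -> norm2 (Q *m x) <= norm2 x.
Proof.
move=> Qs Qi; rewrite -(@ler_pXn2r _ 2)// ?nnegrE ?norm2_ge0//.
suff -> : norm2 x ^+ 2 = norm2 (Q *m x) ^+ 2 + norm2 (x - Q *m x) ^+ 2.
  by rewrite lerDl sqr_ge0.
have h : (Q *m x)^T *m (Q *m x) = x^T *m (Q *m x).
  by rewrite trmx_mul Qs -!mulmxA [Q *m (Q *m x)]mulmxA Qi.
have h' : (Q *m x)^T *m x = x^T *m (Q *m x) by rewrite trmx_mul Qs mulmxA.
have hB : (x - Q *m x)^T = x^T - (Q *m x)^T by apply/matrixP => i j; rewrite !mxE.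
rewrite !norm2_sqrE hB mulmxBl !mulmxBr h h' subrr subr0.
by rewrite [X in _ = _ + X]mxE [X in _ = _ + (_ + X)]mxE addrC subrK.
Qed.

Lemma spectral_norm_pinv_le p r (A : 'M[R]_(p, r)) c : 0 <= c ->
  spectral_norm (mpinv A) <= c <->
  forall y : 'cV[R]_p, norm2 (A^T *m y) <= c * norm2 (A *m (A^T *m y)).
Proof.
move=> c0; have [AXA XAX AXs XAs] := mpinvP A; set X := mpinv A in AXA XAX AXs XAs *.
rewrite spectral_norm_le//; split=> [h y|h x].
  suff -> : norm2 (A^T *m y) = norm2 (X *m (A *m (A^T *m y))) by exact: h.
  by rewrite !mulmxA -XAs -trmx_mul mulmxA AXA.
have -> : X *m x = A^T *m (X^T *m (X *m x)).
  by rewrite !mulmxA -trmx_mul XAs XAX.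
apply: le_trans (h _) _; apply: ler_wpM2l => //.
have -> : A *m (A^T *m (X^T *m (X *m x))) = (A *m X) *m x.
  by rewrite !mulmxA -[A *m A^T *m _]mulmxA -trmx_mul XAs !mulmxA AXA.
by apply: norm2_proj => //; rewrite mulmxA AXA.
Qed.

End pinv_theory.

Section random_matrix.
Context d (T : measurableType d) (R : realType).

(* A random matrix is a matrix of random variables; products are taken in the
   ring of real random variables. *)
Definition outcome (p r : nat) (A : 'M[{mfun T >-> R}]_(p, r)) (t : T) :
  'M[R]_(p, r) := map_mx (fun X : {mfun T >-> R} => X t) A.

Definition fixed_mx (p r : nat) (M : 'M[R]_(p, r)) : 'M[{mfun T >-> R}]_(p, r) :=
  map_mx (fun c => cst c : {mfun T >-> R}) M.

Lemma outcome_fixed_mx p r (M : 'M[R]_(p, r)) t : outcome (fixed_mx M) t = M.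
Proof. by apply/matrixP => i j; rewrite !mxE. Qed.

Lemma mfun_sumE (I : Type) (s : seq I) (F : I -> {mfun T >-> R}) t :
  (\sum_(i <- s) F i) t = \sum_(i <- s) F i t.
Proof. by elim/big_rec2 : _ => //= i _ y _ <-. Qed.

Lemma outcome_mulmx p q r (A : 'M[{mfun T >-> R}]_(p, q))
    (B : 'M[{mfun T >-> R}]_(q, r)) t :
  outcome (A *m B) t = outcome A t *m outcome B t.
Proof.
apply/matrixP => i j; rewrite !mxE mfun_sumE; apply: eq_bigr => k _.
by rewrite !mxE.
Qed.

Lemma outcome_lead_block k p r (hp : (k <= p)%N) (hr : (k <= r)%N)
    (A : 'M[{mfun T >-> R}]_(p, r)) t :
  outcome (lead_block hp hr A) t = lead_block hp hr (outcome A t).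
Proof. by apply/matrixP => i j; rewrite !mxE. Qed.

Lemma measurable_norm2_sqr p r (A : 'M[{mfun T >-> R}]_(p, r)) (z : 'cV[R]_r) :
  measurable_fun setT (fun t => norm2 (outcome A t *m z) ^+ 2).
Proof.
under eq_fun do rewrite norm2_sqr.
apply: measurable_sum => i; apply: measurable_funX.
under eq_fun do rewrite mxE.
apply: measurable_sum => j; apply: measurable_funM => //.
under eq_fun do rewrite mxE.
exact: (@measurable_funPT _ _ _ _ (A i j)).
Qed.

Lemma cvg_bigsum (I : Type) (s : seq I) (f : I -> nat -> R) (l : I -> R) :
  (forall i, f i n @[n --> \oo] --> l i) ->
  \sum_(i <- s) f i n @[n --> \oo] --> \sum_(i <- s) l i.
Proof.
move=> fl; elim: s => [|i s IH].
  by rewrite big_nil; under eq_cvg do rewrite big_nil; exact: cvg_cst.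
by rewrite big_cons; under eq_cvg do rewrite big_cons; exact: cvgD.
Qed.

Lemma cvg_norm2_sqr p r (A : 'M[R]_(p, r)) (z : 'cV[R]_r)
    (u : nat -> 'cV[R]_r) :
  (forall i, u n i 0 @[n --> \oo] --> z i 0) ->
  norm2 (A *m u n) ^+ 2 @[n --> \oo] --> norm2 (A *m z) ^+ 2.
Proof.
move=> uz; under eq_cvg do rewrite norm2_sqr.
rewrite norm2_sqr; apply: cvg_bigsum => i; rewrite expr2.
under eq_cvg do rewrite expr2.
have h : (A *m u n) i 0 @[n --> \oo] --> (A *m z) i 0.
  under eq_cvg do rewrite mxE.
  rewrite mxE; apply: cvg_bigsum => j; apply: cvgM => //; exact: cvg_cst.
exact: cvgM.
Qed.

Lemma rat_approx p (z : 'cV[R]_p) : exists u : nat -> 'cV[rat]_p,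
  forall i, (map_mx ratr (u n) : 'cV[R]_p) i 0 @[n --> \oo] --> z i 0.
Proof.
have h n i : {q : rat | ratr q \in `]z i 0, z i 0 + n.+1%:R^-1[}.
  by apply: cid; apply: rat_in_itvoo; rewrite ltrDl.
exists (fun n => \col_i sval (h n i)) => i.
under eq_cvg do rewrite !mxE.
apply: (@squeeze_cvgr _ _ _ _ (fun=> z i 0) (fun n => z i 0 + n.+1%:R^-1)).
- near=> n; case: (h n i) => /= q; rewrite in_itv/= => /andP[zq qz].
  by rewrite !ltW.
- exact: cvg_cst.
- rewrite -[X in _ --> X]addr0; apply: cvgD; first exact: cvg_cst.
  exact: cvg_harmonic.
Unshelve. all: by end_near. Qed.

Lemma measurable_spectral_norm_pinv p r (A : 'M[{mfun T >-> R}]_(p, r)) :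
  measurable_fun setT (fun t => spectral_norm (mpinv (outcome A t))).
Proof.
pose B : 'M[{mfun T >-> R}]_(r, p) := A^T.
pose C : 'M[{mfun T >-> R}]_p := A *m B.
have BE t : outcome B t = (outcome A t)^T by rewrite /outcome /B map_trmx.
have CE t : outcome C t = outcome A t *m (outcome A t)^T.
  by rewrite outcome_mulmx BE.
have key c : 0 <= c -> [set t | spectral_norm (mpinv (outcome A t)) <= c] =
    \bigcap_(y in [set: 'cV[rat]_p]) [set t |
      norm2 (outcome B t *m map_mx ratr y) ^+ 2 <=
      c ^+ 2 * norm2 (outcome C t *m map_mx ratr y) ^+ 2].
  move=> c0; apply/seteqP; split=> t /=.
    move/(spectral_norm_pinv_le _ c0) => h y _ /=.
    by rewrite -exprMn lerXn2r ?nnegrE ?mulr_ge0 ?norm2_ge0// BE CE -mulmxA.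
  move=> h; apply/(spectral_norm_pinv_le _ c0) => z.
  rewrite -(@ler_pXn2r _ 2)// ?nnegrE ?mulr_ge0 ?norm2_ge0// exprMn.
  rewrite mulmxA -CE -BE; have [u uz] := rat_approx z.
  have uB := cvg_norm2_sqr (A := outcome B t) uz.
  have uC := cvg_norm2_sqr (A := outcome C t) uz.
  apply: (ler_cvg_to uB (cvgM (cvg_cst (c ^+ 2)) uC)).
  by near=> n; exact: h.
have mle c : measurable [set t | spectral_norm (mpinv (outcome A t)) <= c].
  have [c0|c0] := leP 0 c; last first.
    rewrite (_ : [set _ | _] = set0)//; apply/seteqP; split=> t //=.
    by rewrite leNgt (lt_le_trans c0)// spectral_norm_ge0.
  rewrite key//.
  rewrite (_ : \bigcap_(y in _) _ = \bigcap_n (if unpickle n is Some y then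
      [set t | norm2 (outcome B t *m map_mx ratr (y : 'cV[rat]_p)) ^+ 2 <=
        c ^+ 2 * norm2 (outcome C t *m map_mx ratr y) ^+ 2] else setT)).
    apply: bigcapT_measurable => n; case: (unpickle n) => // y.
    rewrite -[X in measurable X]setTI.
    apply: measurable_fun_le => //; first exact: measurable_norm2_sqr.
    by apply: measurable_funM => //; exact: measurable_norm2_sqr.
  apply/seteqP; split=> t /= h.
    by move=> n _; case: (unpickle n) => // y; exact: h.
  by move=> y _; have := h (pickle y) I; rewrite pickleK.
apply: (measurability _ (RGenOInfty.measurableE R)) => //.
move=> _ [_ [a ->] <-]; rewrite setTI.
rewrite (_ : _ @^-1` _ = ~` [set t | spectral_norm (mpinv (outcome A t)) <= a]).
  exact: measurableC.
apply/seteqP; split=> t /=; rewrite in_itv/= andbT ltNge; [by move/negP|].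
by move/negP.
Unshelve. all: by end_near. Qed.

(* At an outcome where A vanishes, mpinv is 0 and the value is 1 / 0 = 0. *)
Definition inv_norm_pinv (p r : nat) (A : 'M[{mfun T >-> R}]_(p, r)) (t : T) : R :=
  1 / spectral_norm (mpinv (outcome A t)).

Lemma measurable_inv_norm_pinv p r (A : 'M[{mfun T >-> R}]_(p, r)) :
  measurable_fun setT (inv_norm_pinv A).
Proof.
have mf := measurable_spectral_norm_pinv A.
apply: (measurability _ (RGenOInfty.measurableE R)) => //.
move=> _ [_ [a ->] <-]; rewrite setTI.
have [a0|a0] := ltP a 0.
  rewrite (_ : _ @^-1` _ = setT)//; apply/seteqP; split=> t //= _.
  by rewrite in_itv/= andbT (lt_le_trans a0)// divr_ge0// spectral_norm_ge0.
rewrite (_ : _ @^-1` _ =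
    ~` ([set t | spectral_norm (mpinv (outcome A t)) <= 0] `|`
        [set t | 1 <= a * spectral_norm (mpinv (outcome A t))])).
  apply: measurableC; apply: measurableU; rewrite -[X in measurable X]setTI.
  - exact: measurable_fun_le.
  - by apply: measurable_fun_le => //; exact: measurable_funM.
apply/seteqP; split=> t /=; rewrite in_itv/= andbT /inv_norm_pinv.
  have [-> |s0] := eqVneq (spectral_norm (mpinv (outcome A t))) 0.
    by rewrite invr0 mulr0 => /(le_lt_trans a0); rewrite ltxx.
  have s1 : 0 < spectral_norm (mpinv (outcome A t)).
    by rewrite lt_neqAle eq_sym s0 spectral_norm_ge0.
  by rewrite ltr_pdivlMr// => h; case; rewrite leNgt ?s1 ?h.
move=> /not_orP[/negP + /negP]; rewrite -!ltNge => s0 h.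
by rewrite ltr_pdivlMr.
Qed.

HB.instance Definition _ p r (A : 'M[{mfun T >-> R}]_(p, r)) :=
  isMeasurableFun.Build _ _ _ _ (inv_norm_pinv A) (measurable_inv_norm_pinv A).

End random_matrix.

Section gaussian_matrix.
Context d (T : measurableType d) (R : realType) (P : probability T R).

Definition mutually_independent (I : finType) (X : I -> {RV P >-> R}) : Prop :=
  forall (J : {set I}) (B : I -> set R), (forall i, measurable (B i)) ->
    P (\bigcap_(i in [set` J]) X i @^-1` B i) =
    (\prod_(i in J) P (X i @^-1` B i))%E.

(* [normal_prob] takes the standard deviation, not the variance. *)
Definition gaussian_matrix (p r : nat) (mu sigma : R)
    (A : 'M[{RV P >-> R}]_(p, r)) : Prop :=
  (forall i j (B : set R), measurable B ->
     distribution P (A i j) B = normal_prob mu sigma B) /\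
  mutually_independent (fun ij : 'I_p * 'I_r => A ij.1 ij.2).

End gaussian_matrix.

(* Main.v *)
(* The idea, following Sankar, Spielman and Teng. Fix a vector [v] and let
   [A = B + Z N] with [Z] a matrix of independent standard normal entries and
   [|w| <= k |N w|] for all [w]. Rotating the rows of [Z], one may take [v] along
   the first axis; then [A^-1 v = (|v| / det A) C] with [C] the vector of first-row
   cofactors, which does not involve the first row of [A], while [det A] is
   conditionally a normal variable of standard deviation [|N C| >= |C| / k].
   Since the normal density is at most [1 / sqrt (2 pi)],
     P (|A^-1 v| > z) <= sqrt (2 / pi) |v| k / z.
   Now average over an independent standard normal vector [v]. If
   [|A^T a| < y |a|] then [|<v, a>| <= |A^-1 v| |A^T a|] forces [|A^-1 v| > t / y]
   as soon as [|<v, a>| >= t |a|], an event of probability [P (|xi| >= t)] with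
   [xi] standard normal. As [E |v| <= sqrt p], this yields
     P (exists a, |A^T a| < y |a|) * P (|xi| >= t) <= sqrt (2 / pi) y k sqrt p / t,
   and [t = 3/4] gives the constant [2.35]. *)
Require Import Defs.
From HB Require Import structures.
From mathcomp Require Import all_boot all_order all_algebra.
From mathcomp Require Import all_classical all_reals all_analysis.
From mathcomp Require Import measurable_realfun ring lra.

Set Implicit Arguments.
Unset Strict Implicit.
Unset Printing Implicit Defensive.

Import Order.TTheory GRing.Theory Num.Theory.
Import numFieldNormedType.Exports.

Local Open Scope classical_set_scope.
Local Open Scope ring_scope.

(** * Lebesgue and normal integrals on the line and the plane *)

Section lebesgue_affine.
Context {R : realType}.
Notation mu := (@lebesgue_measure R).
Local Open Scope ereal_scope.

(** The entries live on an arbitrary probability space and are known only through their laws and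
    mutual independence; no vector can be adjoined to that space. Conditioning is therefore
    expressed by iterated integrals on the line: independence allows one coordinate after another to
    be replaced by an integration against the standard normal law, and the averaged vector [v] is
    never more than a list of integration variables. Rotation invariance is reduced in the same way
    to a plane. The leading block of [G M] is the first [j] rows of [G] times [M_j]. Standardizing
    these rows sends the mean into [B] and gives [N = sigma M_j], a rectangular matrix, with
    [k = |M_j^+| / sigma]; the block of [M H] follows by transposition. Singular outcomes, where
    [A^-1 v] has no meaning, are shown to be null by induction on minors. The same fact gives full
    rank almost surely, after multiplying [M] on the right so that [G M C] is square. *)

Lemma measurable_affine (a b : R) :
  measurable_fun [set: measurableTypeR R]
    (fun x => a * x + b : measurableTypeR R)%R.
Proof. by apply: measurable_funD => //; exact: measurable_funM. Qed.

(** The rescaled image measure agrees with Lebesgue measure on half-open intervals, and these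
    determine it. *)
Lemma lebesgue_measure_affine (a b : R) (A : set R) : (0 < a)%R ->
  measurable A ->
  mu A = a%:E * pushforward mu (fun x => a * x + b : measurableTypeR R)%R A.
Proof.
move=> a0 mA.
pose nu := measure_function_pushforward__canonical__measure_function_Measure
  mu (measurable_affine a b).
rewrite -[RHS]/(mscale (NngNum (ltW a0)) nu A).
apply: lebesgue_measure_unique => //=.
move=> _ [[l r] _ <-]; rewrite /nu /mscale/= /pushforward/=.
have -> : ((fun x : R => a * x + b) @^-1` `]l, r] =
    `](l - b) / a, (r - b) / a]%classic)%R.
  apply/seteqP; split=> x /=; rewrite !in_itv/= ltr_pdivrMr// ler_pdivlMr//;
    by rewrite ltrBlDr lerBrDr ![(x * a)%R]mulrC.
rewrite !lebesgue_measure_itv/= !lte_fin ltr_pM2r ?invr_gt0// ltrD2r.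
case: ifPn => _; last by rewrite mule0.
rewrite -!EFinB -EFinM; congr EFin; field; exact: lt0r_neq0.
Qed.

Lemma ge0_integral_affine (f : R -> \bar R) (a b : R) : (0 < a)%R ->
  measurable_fun setT f -> (forall x, 0 <= f x) ->
  \int[mu]_x f x = a%:E * \int[mu]_x f (a * x + b)%R.
Proof.
move=> a0 mf f0; have mg := measurable_affine a b.
pose nu := measure_function_pushforward__canonical__measure_function_Measure
  mu mg.
transitivity (a%:E * \int[nu]_x f x); last by rewrite ge0_integral_pushforward.
rewrite -[a]/((NngNum (ltW a0))%:num) -ge0_integral_mscale//.
by apply: eq_measure_integral => A mA _; exact: lebesgue_measure_affine.
Qed.

Lemma ge0_integral_translation (f : R -> \bar R) (b : R) :
  measurable_fun setT f -> (forall x, 0 <= f x) ->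
  \int[mu]_x f (x + b)%R = \int[mu]_x f x.
Proof.
move=> mf f0; rewrite (ge0_integral_affine b ltr01 mf f0) mul1e.
by under [RHS]eq_integral do rewrite mul1r.
Qed.

End lebesgue_affine.

Section gauss.
Context {R : realType}.
Notation mu := (@lebesgue_measure R).
Local Open Scope ereal_scope.
Import HBNNSimple.
(** On indicators this is the definition of [normal_prob]; linearity extends it to simple functions,
    and monotone convergence on both sides to [f]. *)
Lemma ge0_integral_normal_prob (m s : R) (f : R -> \bar R) :
  measurable_fun setT f -> (forall x, 0 <= f x) ->
  \int[normal_prob m s]_x f x = \int[mu]_x (f x * (normal_pdf m s x)%:E).
Proof.
move=> mf f0; pose h := nnsfun_approx measurableT mf.
pose g x := (normal_pdf m s x)%:E.
have mg : measurable_fun setT g.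
  by apply/measurable_EFinP; exact: measurable_normal_pdf.
have g0 x : 0 <= g x by rewrite lee_fin normal_pdf_ge0.
have hf x : (h n x)%:E @[n --> \oo] --> f x by exact: cvg_nnsfun_approx.
have mh n : measurable_fun [set: R] (fun x => (h n x)%:E).
  exact/measurable_EFinP/measurable_funPT.
have ndh x : {homo (fun n => (h n x)%:E) : a b / (a <= b)%N >-> a <= b}.
  by move=> a b ab; rewrite lee_fin; exact/lefP/nd_nnsfun_approx.
transitivity (limn (fun n => \int[normal_prob m s]_x (h n x)%:E)).
  rewrite -monotone_convergence//.
  - by apply: eq_integral => x _; exact/esym/cvg_lim.
  - by move=> n x _; rewrite lee_fin.
transitivity (limn (fun n => \int[mu]_x ((h n x)%:E * g x))); last first.
  rewrite -monotone_convergence//.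
  - apply: eq_integral => x _; apply/cvg_lim => //.
    by apply: cvgeZr => //; exact: hf.
  - by move=> n; apply: emeasurable_funM => //; exact: mh.
  - by move=> n x _; rewrite mule_ge0// lee_fin.
  - by move=> x _ a b ab; apply: lee_wpmul2r => //; exact: ndh.
congr (limn _); apply/funext => n.
have mi y : measurable_fun [set: R] (fun x => (y * \1_(h n @^-1` [set y]) x)%:E).
  by apply/measurable_EFinP; apply: measurable_funM => //; exact: measurable_indic.
transitivity (\sum_(y \in range (h n))
    \int[normal_prob m s]_x (y * \1_(h n @^-1` [set y]) x)%:E).
  under eq_integral do rewrite fimfunE -fsumEFin//.
  rewrite ge0_integral_fsum//.
  - by move=> y x _; exact: nnfun_muleindic_ge0.
transitivity (\sum_(y \in range (h n))
    \int[mu]_x ((y * \1_(h n @^-1` [set y]) x)%:E * g x)); last first.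
  rewrite -ge0_integral_fsum//.
  - apply: eq_integral => x _; rewrite -ge0_mule_fsuml; last first.
      by move=> y; exact: nnfun_muleindic_ge0.
    by rewrite fsumEFin// -fimfunE.
  - by move=> y; apply: emeasurable_funM => //; exact: mi.
  - by move=> y x _; rewrite mule_ge0// nnfun_muleindic_ge0.
apply: eq_fsbigr => r /[!inE] -[x _ <-].
under eq_integral do rewrite EFinM.
under [RHS]eq_integral do rewrite EFinM -muleA.
have mhn : measurable (h n @^-1` [set h n x]) by [].
have m1 : measurable_fun [set: R] (fun y => (\1_(h n @^-1` [set h n x]) y : R)%:E).
  exact/measurable_EFinP/measurable_indic.
rewrite ge0_integralZl ?lee_fin//.
rewrite ge0_integralZl ?lee_fin//; last 2 first.
- exact: emeasurable_funM.
- by move=> y _; rewrite mule_ge0// lee_fin.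
congr (_ * _); rewrite integral_indic// setIT /= /normal_prob [LHS]integral_mkcond.
by apply: eq_integral => y _; rewrite epatch_indic /= muleC.
Qed.
End gauss.

Section rotation.
Context {R : realType}.
Notation mu := (@lebesgue_measure R).
Local Open Scope ereal_scope.

Lemma measurable_fun2_comp d (S : measurableType d) (f : R -> R -> \bar R)
    (g h : S -> R) :
  measurable_fun setT (fun z : R * R => f z.1 z.2) ->
  measurable_fun setT g -> measurable_fun setT h ->
  measurable_fun setT (fun z => f (g z) (h z)).
Proof.
by move=> mf mg mh; exact: (measurableT_comp mf (measurable_fun_pair mg mh)).
Qed.

Lemma ge0_integral2_shear (f : R -> R -> \bar R) (a : R) :
  measurable_fun setT (fun z : R * R => f z.1 z.2) ->
  (forall x y, 0 <= f x y) ->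
  \int[mu]_x \int[mu]_y f x (y + a * x)%R = \int[mu]_x \int[mu]_y f x y.
Proof.
move=> mf f0; apply: eq_integral => x _.
rewrite (ge0_integral_translation (f := f x))//.
exact: (measurable_fun2_comp mf).
Qed.

Lemma ge0_integral2_swap (f : R -> R -> \bar R) :
  measurable_fun setT (fun z : R * R => f z.1 z.2) ->
  (forall x y, 0 <= f x y) ->
  \int[mu]_x \int[mu]_y f x y = \int[mu]_y \int[mu]_x f x y.
Proof.
by move=> mf f0; exact: (@fubini_tonelli _ _ _ _ R mu mu
  (fun z : measurableTypeR R * measurableTypeR R => f z.1 z.2)).
Qed.

(* A rotation of angle other than [pi] is a product of three shears, each of which
   preserves integrals by translation invariance on a line. *)
Lemma ge0_integral2_rotation (f : R -> R -> \bar R) (c s : R) :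
  measurable_fun setT (fun z : R * R => f z.1 z.2) ->
  (forall x y, 0 <= f x y) ->
  (c ^+ 2 + s ^+ 2 = 1)%R -> (c != -1)%R ->
  \int[mu]_x \int[mu]_y f (c * x + s * y)%R (c * y - s * x)%R =
  \int[mu]_x \int[mu]_y f x y.
Proof.
move=> mf f0 cs1 c1; have c10 : (1 + c != 0)%R by rewrite addrC addr_eq0.
(* The tangent of half the angle, undefined exactly when [c = -1]. The three shears have parameters
   [t], [- s] and [t]. *)
pose t := (s / (1 + c))%R.
have cE : (c = 1 - s * t)%R.
  apply: (mulIf c10); rewrite /t mulrBl -mulrA divfK// mul1r -expr2; lra.
have sE : (s = t + t * c)%R by rewrite /t; field.
have mfc := measurable_fun2_comp mf.
pose f1 (x y : R) := f (x + t * y)%R y.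
have mf1 : measurable_fun setT (fun z : R * R => f1 z.1 z.2).
  by apply: mfc => //; apply: measurable_funD => //; exact: measurable_funM.
pose g (x y : R) := f1 x (y + - s * x)%R.
have mg : measurable_fun setT (fun z : R * R => g z.1 z.2).
  by apply: (measurable_fun2_comp mf1) => //; apply: measurable_funD => //;
    exact: measurable_funM.
pose g1 (x y : R) := g (x + t * y)%R y.
have mg1 : measurable_fun setT (fun z : R * R => g1 z.1 z.2).
  by apply: (measurable_fun2_comp mg) => //; apply: measurable_funD => //;
    exact: measurable_funM.
(* A shear of the first variable becomes a shear of the second once the order of integration is
   exchanged. *)
have shear1 (h h1 : R -> R -> \bar R) :
    measurable_fun setT (fun z : R * R => h z.1 z.2) -> (forall x y, 0 <= h x y) ->
    measurable_fun setT (fun z : R * R => h1 z.1 z.2) ->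
    h1 = (fun x y => h (x + t * y)%R y) ->
    \int[mu]_x \int[mu]_y h1 x y = \int[mu]_x \int[mu]_y h x y.
  move=> mh h0 mh1 h1E.
  have mhs : measurable_fun setT (fun z : R * R => h z.2 z.1).
    exact: (measurable_fun2_comp mh).
  rewrite (ge0_integral2_swap mh1); last by move=> x y; rewrite h1E.
  rewrite (ge0_integral2_swap mh h0) h1E.
  exact: (ge0_integral2_shear t mhs (fun x y => h0 y x)).
have <- := shear1 f f1 mf f0 mf1 erefl.
have <- := ge0_integral2_shear (- s) mf1 (fun x y => f0 _ _).
have <- := shear1 g g1 mg (fun x y => f0 _ _) mg1 erefl.
apply: eq_integral => x _; apply: eq_integral => y _; rewrite /g1 /g /f1.
clearbody t; congr f; last by rewrite cE; ring.
transitivity (c * x + (t + t * c) * y)%R; first by rewrite -sE.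
by rewrite cE; ring.
Qed.
End rotation.

Section std_normal.
Context {R : realType}.
Notation mu := (@lebesgue_measure R).
Local Notation gamma := (normal_prob (0 : R) 1).
Local Notation phi := (normal_pdf (0 : R) 1).
Local Open Scope ereal_scope.

Lemma std_normal_pdfE (x : R) : phi x = (normal_peak 1 * expR (- (x ^+ 2 / 2)))%R.
Proof.
by rewrite normal_pdfE ?oner_neq0// /normal_fun subr0 expr1n mulNr.
Qed.

Lemma normal_pdf_standardize (m s x : R) : (0 < s)%R ->
  (s * normal_pdf m s (s * x + m) = phi x)%R.
Proof.
move=> s0; rewrite std_normal_pdfE normal_pdfE ?gt_eqF//.
rewrite /normal_fun addrK mulNr mulrA; congr (_ * expR (- _))%R.
  rewrite /normal_peak expr1n mul1r -mulrnAr sqrtrM ?sqr_ge0// sqrtr_sqr gtr0_norm//.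
  by rewrite invfM mulrA divff ?gt_eqF// mul1r.
by rewrite exprMn -mulr_natl; field; rewrite gt_eqF.
Qed.

Lemma normal_prob_standardize (m s : R) (B : set R) : (0 < s)%R -> measurable B ->
  normal_prob m s ((fun x => (x - m) / s)%R @^-1` B) = gamma B.
Proof.
move=> s0 mB.
pose S : set R := ((fun x => (x - m) / s)%R @^-1` B).
have mS : measurable S.
  rewrite -[X in measurable X]setTI; apply: measurable_funM => //.
  exact: measurable_funB.
have mpdf (a b : R) : measurable_fun setT (fun x => (normal_pdf a b x)%:E).
  by apply/measurable_EFinP; exact: measurable_normal_pdf.
have mi (A : set R) : measurable A -> measurable_fun setT (fun x => (\1_A x : R)%:E).
  move=> mA; exact/measurable_EFinP/measurable_indic.
have E a b (A : set R) : measurable A ->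
    normal_prob a b A = \int[mu]_x ((\1_A x)%:E * (normal_pdf a b x)%:E).
  move=> mA; rewrite -ge0_integral_normal_prob//; last exact: mi.
  by rewrite (integral_indic (normal_prob a b) measurableT mA) setIT.
rewrite (E m s S mS) (E 0%R 1%R B mB).
rewrite (ge0_integral_affine m s0); last 2 first.
- by apply: emeasurable_funM => //; exact: mi.
- by move=> x; rewrite mule_ge0// lee_fin normal_pdf_ge0.
have mB' : measurable_fun setT
    (fun x => (\1_S (s * x + m)%R)%:E * (normal_pdf m s (s * x + m)%R)%:E).
  apply: (measurableT_comp (f := fun x => (\1_S x)%:E * (normal_pdf m s x)%:E)).
    by apply: emeasurable_funM => //; exact: mi.
  by apply: measurable_funD => //; exact: measurable_funM.
rewrite -ge0_integralZl//=; last 2 first.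
- by move=> x _; rewrite mule_ge0// lee_fin normal_pdf_ge0.
- by rewrite lee_fin ltW.
apply: eq_integral => x _.
have -> : (\1_S (s * x + m) = \1_B x :> R)%R.
  by rewrite -[LHS]/(\1_B ((s * x + m - m) / s))%R addrK mulrAC divff ?mul1r// gt_eqF.
by rewrite muleCA -EFinM normal_pdf_standardize.
Qed.

(** The product density [phi x * phi y] depends only on [x ^+ 2 + y ^+ 2], so it can be carried
    through the rotation formula for Lebesgue measure. *)
Lemma ge0_integral_std_normal_rotation (f : R -> R -> \bar R) (c s : R) :
  measurable_fun setT (fun z : R * R => f z.1 z.2) ->
  (forall x y, 0 <= f x y) ->
  (c ^+ 2 + s ^+ 2 = 1)%R -> (c != -1)%R ->
  \int[gamma]_x \int[gamma]_y f (c * x + s * y)%R (c * y - s * x)%R =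
  \int[gamma]_x \int[gamma]_y f x y.
Proof.
move=> mf f0 cs1 c1.
have mphi : measurable_fun setT phi by exact: measurable_normal_pdf.
pose F x y := f x y * (phi x * phi y)%:E.
have F0 x y : 0 <= F x y.
  by rewrite mule_ge0// lee_fin mulr_ge0// normal_pdf_ge0.
have mF : measurable_fun setT (fun z : R * R => F z.1 z.2).
  apply: emeasurable_funM => //; apply/measurable_EFinP.
  by apply: measurable_funM; apply: measurableT_comp.
have key (g : R -> R -> \bar R) : measurable_fun setT (fun z : R * R => g z.1 z.2) ->
    (forall x y, 0 <= g x y) ->
    \int[gamma]_x \int[gamma]_y g x y =
    \int[mu]_x \int[mu]_y (g x y * (phi x * phi y)%:E).
  move=> mg g0.
  rewrite ge0_integral_normal_prob; last 2 first.
  - by apply: (@measurable_fun_fubini_tonelli_F _ _ R (measurableTypeR R) R gamma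
      (fun z => g z.1 z.2)).
  - by move=> x; apply: integral_ge0.
  apply: eq_integral => x _.
  have mgx : measurable_fun setT (g x) by exact: (measurable_fun2_comp mg).
  rewrite ge0_integral_normal_prob// -ge0_integralZr//=; last 3 first.
  - by apply: emeasurable_funM => //; apply/measurable_EFinP.
  - by move=> y _; rewrite mule_ge0// lee_fin normal_pdf_ge0.
  - by rewrite lee_fin normal_pdf_ge0.
  by apply: eq_integral => y _; rewrite -muleA -EFinM [in RHS]mulrC.
rewrite key//; last first.
  apply: (measurable_fun2_comp mf); [apply: measurable_funD|apply: measurable_funB];
    exact: measurable_funM.
rewrite (key f mf f0); have <- := ge0_integral2_rotation mF F0 cs1 c1.
apply: eq_integral => x _; apply: eq_integral => y _.
rewrite /F; congr (_ * _%:E); rewrite !std_normal_pdfE.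
rewrite mulrACA [RHS]mulrACA -!expRD; congr (_ * expR _)%R.
rewrite -!opprD -!mulrDl; congr (- (_ / _))%R.
transitivity ((c ^+ 2 + s ^+ 2) * (x ^+ 2 + y ^+ 2))%R; first by rewrite cs1 mul1r.
by ring.
Qed.

(** The event is an interval of length [2 * e / r], and the density is at most
    [normal_peak 1 = 1 / sqrt (2 pi)]. The factor [2 * normal_peak 1], here and later, is thus
    [sqrt (2 / pi)]. *)
Lemma std_normal_interval (b r e : R) : (0 < r)%R -> (0 <= e)%R ->
  gamma [set x | `|b + r * x| < e]%R <= (2 * normal_peak 1 * e / r)%:E.
Proof.
move=> r0 e0.
have -> : [set x | `|b + r * x| < e]%R = `]((- e - b) / r)%R, ((e - b) / r)%R[%classic.
  apply/seteqP; split => x /=; rewrite in_itv/= ltr_norml ltr_pdivrMr// ltr_pdivlMr//;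
    by rewrite ltrBlDr ltrBrDr mulrC addrC.
have [e00|e00] := eqVneq e 0%R.
  by rewrite e00 oppr0 set_itvoo0 measure0 mulr0 mul0r.
apply: (@le_trans _ _
    (\int[mu]_(x in `]((- e - b) / r)%R, ((e - b) / r)%R[) (normal_peak 1)%:E)).
  apply: ge0_le_integral => //=.
  - by move=> x _; rewrite lee_fin normal_pdf_ge0.
  - by apply/measurable_EFinP; apply: measurable_funTS; exact: measurable_normal_pdf.
  - by move=> x _; rewrite lee_fin normal_pdf_ub// oner_neq0.
rewrite integral_cst//= lebesgue_measure_itv/= lte_fin.
rewrite ltr_pM2r ?invr_gt0// ltrD2r gtrN ?lt_neqAle 1?eq_sym ?e00// -EFinD -EFinM lee_fin.
by rewrite le_eqVlt; apply/orP; left; apply/eqP; field; rewrite gt_eqF.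
Qed.

(** A comparison of [phi x] with the dilated density [phi (s * x)], of integral [1 / s], takes the
    place of integration by parts. It gives [m <= 2 / (s * (1 + s))] for every [s] in []0, 1[],
    whence the bound as [s] tends to 1. *)
Lemma std_normal_second_moment : \int[gamma]_x (x ^+ 2)%:E <= 1.
Proof.
have mphi : measurable_fun setT phi by exact: measurable_normal_pdf.
have mp : measurable_fun setT (fun x => (phi x)%:E) by exact/measurable_EFinP.
have p0 (x : R) : 0 <= (phi x)%:E by rewrite lee_fin normal_pdf_ge0.
rewrite ge0_integral_normal_prob//; last 2 first.
  by apply/measurable_EFinP; exact: measurable_funX.
  by move=> x; rewrite lee_fin sqr_ge0.
under eq_integral do rewrite -EFinM.
set m := integral _ _ _.
have mx : measurable_fun setT (fun x : R => (x ^+ 2 * phi x)%:E).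
  by apply/measurable_EFinP/measurable_funM => //; exact: measurable_funX.
have x0 (x : R) : 0 <= (x ^+ 2 * phi x)%:E.
  by rewrite lee_fin mulr_ge0 ?sqr_ge0 ?normal_pdf_ge0.
have m0 : 0 <= m by apply: integral_ge0.
(* [1 + w <= expR w] gives [phi x * (1 + (1 - s^2) x^2 / 2) <= phi (s x)]. *)
have key (s : R) : (0 < s < 1)%R -> 1 + ((1 - s ^+ 2) / 2)%:E * m <= (s^-1)%:E.
  move=> /andP[s0 s1].
  have h0 : (0 <= (1 - s ^+ 2) / 2)%R.
    by rewrite divr_ge0// subr_ge0 expr_le1// ltW.
  have <- : \int[mu]_x (phi (s * x)%R)%:E = s^-1%:E.
    have := integral_normal_pdf (0 : R) 1.
    rewrite (ge0_integral_affine 0 s0)//; under eq_integral do rewrite addr0.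
    by move=> h; rewrite -[RHS]mule1 -h muleA -EFinM mulVf ?gt_eqF// mul1e.
  rewrite -(integral_normal_pdf (0 : R) 1) /m -ge0_integralZl// -ge0_integralD//; last 2 first.
  - by move=> x _; rewrite mule_ge0.
  - exact: measurable_funeM.
  apply: ge0_le_integral => //.
  - by move=> x _; rewrite adde_ge0// mule_ge0.
  - by apply: emeasurable_funD => //; exact: measurable_funeM.
  - apply/measurable_EFinP; apply: measurableT_comp => //; exact: measurable_funM.
  move=> x _; rewrite -EFinM -EFinD lee_fin !std_normal_pdfE.
  rewrite [leLHS](_ : _ = normal_peak 1 *
    (expR (- (x ^+ 2 / 2)) * (1 + (1 - s ^+ 2) / 2 * x ^+ 2)))%R; last by ring.
  rewrite ler_pM2l ?normal_peak_gt0 ?oner_neq0//.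
  rewrite (_ : - ((s * x) ^+ 2 / 2) =
    - (x ^+ 2 / 2) + (1 - s ^+ 2) / 2 * x ^+ 2)%R; last by field.
  by rewrite expRD ler_pM2l ?expR_gt0// expR_ge1Dx.
(* At [s = 1 / 2], [key] bounds a positive multiple of [m] by a finite number. *)
have mfin : m \is a fin_num.
  rewrite ge0_fin_numE// ltNge leye_eq; apply/eqP => moo.
  have := key (2^-1)%R; rewrite moo gt0_muley ?addey// ?lte_fin; last lra.
  by move=> /(_ _)/=; rewrite leye_eq => h; have : false by apply: h; lra.
rewrite -(fineK mfin) lee_fin leNgt; apply/negP => r1; set r := fine m in r1.
(* An explicit [s] in place of the limit: here [r * s = (2 * r + 1) / 3], and the bound on [r] turns
   into [(r - 1) * (10 * r - 1) <= 0], false for [r > 1]. *)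
pose s : R := (1 - (r - 1) / (3 * r))%R.
have r0 : (0 < r)%R by clear - r1; lra.
have sE : (r * (1 - s) = (r - 1) / 3)%R by rewrite /s; field; rewrite gt_eqF.
clearbody s.
have s01 : (0 < s < 1)%R.
  apply/andP; split; first by rewrite -(pmulr_rgt0 _ r0); clear - sE r1; lra.
  by rewrite -subr_gt0 -(pmulr_rgt0 _ r0); clear - sE r1; lra.
have := key _ s01; rewrite -(fineK mfin) -/r -EFinM -EFinD lee_fin.
move/andP : s01 => [s0 s1]; rewrite -(ler_pM2r s0) mulVf ?gt_eqF// => h.
clear - h sE r1 s0 s1 r0.
have h1 : ((1 + s) * (r * s) <= 2)%R.
  rewrite -(ler_pM2l (_ : 0 < (1 - s) / 2)%R); last lra.
  apply: (@le_trans _ _ ((1 + (1 - s ^+ 2) / 2 * r) * s - s)%R); last lra.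
  by rewrite le_eqVlt; apply/orP; left; apply/eqP; field.
have h2 : (r * s = (2 * r + 1) / 3)%R by lra.
have h3 : ((r + r * s) * (r * s) <= 2 * r)%R.
  rewrite [leRHS]mulrC [leLHS](_ : _ = r * ((1 + s) * (r * s)))%R; last ring.
  by rewrite ler_pM2l.
rewrite h2 in h3.
have : (0 < (r - 1) * (10 * r - 1))%R by apply: mulr_gt0; lra.
lra.
Qed.
End std_normal.

(** * The constant 2.35 *)

Section taylor.
Context {R : realType}.
Implicit Types x : R.

Lemma ge0_of_is_derive (f df : R -> R) : f 0 = 0 ->
  (forall x, is_derive x 1 f (df x)) -> (forall x, 0 <= x -> 0 <= df x) ->
  forall x, 0 <= x -> 0 <= f x.
Proof.
move=> f0 dfE df0 x x0.
have [] := @MVT_segment _ f df 0 x x0 (fun y _ => dfE y).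
  apply: continuous_subspaceT => y; apply: differentiable_continuous.
  by apply/derivable1_diffP; case: (dfE y).
move=> c; rewrite in_itv/= f0 !subr0 => /andP[c0 _] ->.
by rewrite mulr_ge0// df0.
Qed.

Lemma le_of_is_derive (f df g dg : R -> R) : f 0 = g 0 ->
  (forall x, is_derive x 1 f (df x)) -> (forall x, is_derive x 1 g (dg x)) ->
  (forall x, 0 <= x -> df x <= dg x) -> forall x, 0 <= x -> f x <= g x.
Proof.
move=> fg0 fE gE dfg x x0; rewrite -subr_ge0.
apply: (@ge0_of_is_derive (g - f) (fun t => dg t - df t)) x x0.
- by rewrite !fctE fg0 subrr.
- by move=> y y0; rewrite subr_ge0 dfg.
Qed.

(** Integrating [cos <= 1] from 0 six times yields Taylor bounds for [sin] and [cos] in turn; each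
    of [h1] to [h6] is the derivative comparison with the preceding one. *)
Lemma cos_ge_taylor6 x : 0 <= x ->
  1 - x ^+ 2 / 2 + x ^+ 4 / 24 - x ^+ 6 / 720 <= cos x.
Proof.
pose s1 : {poly R} := 'X.
pose c2 : {poly R} := 1 - 2^-1 *: 'X^2.
pose s3 : {poly R} := 'X - 6^-1 *: 'X^3.
pose c4 : {poly R} := 1 - 2^-1 *: 'X^2 + 24^-1 *: 'X^4.
pose s5 : {poly R} := 'X - 6^-1 *: 'X^3 + 120^-1 *: 'X^5.
pose c6 : {poly R} := 1 - 2^-1 *: 'X^2 + 24^-1 *: 'X^4 - 720^-1 *: 'X^6.
have dcos (y : R) : is_derive y 1 (fun t => - cos t) (sin y).
  by have := is_deriveN (is_derive_cos y); rewrite opprK.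
have dN (p : {poly R}) (y : R) : is_derive y 1 (fun t => - p.[t]) (- p^`()).[y].
  by rewrite hornerN; exact: is_deriveN.
have h1 : forall y, 0 <= y -> sin y <= s1.[y].
  apply: (le_of_is_derive _ (@is_derive_sin R) (is_derive_poly s1)).
  - by rewrite sin0 hornerX.
  - by move=> y _; rewrite derivX hornerC cos_le1.
have h2 : forall y, 0 <= y -> - cos y <= - c2.[y].
  apply: (le_of_is_derive _ dcos (dN c2)).
  - rewrite cos0 /c2 !hornerE/=; lra.
  - move=> y y0; apply: le_trans (h1 _ y0) _.
    by rewrite /c2 /s1 !poly.derivE !hornerE/=; lra.
have h3 : forall y, 0 <= y -> s3.[y] <= sin y.
  apply: (le_of_is_derive _ (is_derive_poly s3) (@is_derive_sin R)).
  - by rewrite sin0 /s3 !hornerE/=; lra.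
  - move=> y y0; rewrite -[leRHS]opprK lerNr; apply: le_trans (h2 _ y0) _.
    by rewrite /c2 /s3 !poly.derivE !hornerE/=; lra.
have h4 : forall y, 0 <= y -> - c4.[y] <= - cos y.
  apply: (le_of_is_derive _ (dN c4) dcos).
  - by rewrite cos0 /c4 !hornerE/=; lra.
  - move=> y y0; apply: le_trans (h3 _ y0).
    by rewrite /c4 /s3 !poly.derivE !hornerE/=; lra.
have h5 : forall y, 0 <= y -> sin y <= s5.[y].
  apply: (le_of_is_derive _ (@is_derive_sin R) (is_derive_poly s5)).
  - by rewrite sin0 /s5 !hornerE/=; lra.
  - move=> y y0; rewrite -[leLHS]opprK lerNl; apply: le_trans (h4 _ y0).
    by rewrite /c4 /s5 !poly.derivE !hornerE/=; lra.
have h6 : forall y, 0 <= y -> - cos y <= - c6.[y].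
  apply: (le_of_is_derive _ dcos (dN c6)).
  - by rewrite cos0 /c6 !hornerE/=; lra.
  - move=> y y0; apply: le_trans (h5 _ y0) _.
    by rewrite /c6 /s5 !poly.derivE !hornerE/=; lra.
move=> x0; have := h6 _ x0; rewrite lerN2; apply: le_trans.
by rewrite /c6 !hornerE/=; lra.
Qed.

(** The tangent bound [1 - x <= expR (- x)], integrated three times from 0; the direction of the
    inequality alternates. *)
Lemma expRN_le_taylor4 x : 0 <= x ->
  expR (- x) <= 1 - x + x ^+ 2 / 2 - x ^+ 3 / 6 + x ^+ 4 / 24.
Proof.
pose e1 : {poly R} := 1 - 'X.
pose e2 : {poly R} := 1 - 'X + 2^-1 *: 'X^2.
pose e3 : {poly R} := 1 - 'X + 2^-1 *: 'X^2 - 6^-1 *: 'X^3.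
pose e4 : {poly R} := 1 - 'X + 2^-1 *: 'X^2 - 6^-1 *: 'X^3 + 24^-1 *: 'X^4.
have de (y : R) : is_derive y 1 (fun t => expR (- t)) (- expR (- y)).
  have := is_derive1_comp (is_derive_expR (- y)) (is_deriveNid y 1).
  by rewrite mulrN1.
have h1 y : 0 <= y -> e1.[y] <= expR (- y).
  by move=> _; rewrite /e1 !hornerE/=; exact: expR_ge1Dx.
have h2 : forall y, 0 <= y -> expR (- y) <= e2.[y].
  apply: (le_of_is_derive _ de (is_derive_poly e2)).
  - by rewrite oppr0 expR0 /e2 !hornerE/=; lra.
  - move=> y y0; rewrite lerNl; apply: le_trans (h1 _ y0).
    by rewrite /e1 /e2 !poly.derivE !hornerE/=; lra.
have h3 : forall y, 0 <= y -> e3.[y] <= expR (- y).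
  apply: (le_of_is_derive _ (is_derive_poly e3) de).
  - by rewrite oppr0 expR0 /e3 !hornerE/=; lra.
  - move=> y y0; rewrite lerNr; apply: le_trans (h2 _ y0) _.
    by rewrite /e2 /e3 !poly.derivE !hornerE/=; lra.
have h4 : forall y, 0 <= y -> expR (- y) <= e4.[y].
  apply: (le_of_is_derive _ de (is_derive_poly e4)).
  - by rewrite oppr0 expR0 /e4 !hornerE/=; lra.
  - move=> y y0; rewrite lerNl; apply: le_trans (h3 _ y0).
    by rewrite /e3 /e4 !poly.derivE !hornerE/=; lra.
move=> x0; have := h4 _ x0; move/le_trans; apply.
by rewrite /e4 !hornerE/=; lra.
Qed.

(** The Taylor bound of degree six is still positive at [1883 / 1200], whereas [cos] would be
    negative there if [pi / 2] were smaller. *)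
Lemma pi_ge : 1883 / 600 <= pi :> R.
Proof.
rewrite leNgt; apply/negP => h.
pose a : R := 1883 / 1200.
have a0 : 0 <= a by rewrite /a; lra.
have ha : pi / 2 < a by rewrite /a; lra.
have := pi_ge2 R => p2.
have ca : cos a < cos (pi / 2).
  rewrite ltr_cos// ?in_itv/=; first by lra.
  by apply/andP; split=> //; rewrite /a; lra.
have := le_lt_trans (cos_ge_taylor6 a0) ca; rewrite cos_pihalf.
by rewrite /a ltNge => /negP; apply; lra.
Qed.
End taylor.

Section numeric.
Context {R : realType}.
Notation mu := (@lebesgue_measure R).
Local Notation gamma := (normal_prob (0 : R) 1).

(** A rational number within 0.06% above [sqrt (2 / pi)]. The tail inequality at [3 / 4] still holds
    with it, with almost no room left. *)
Lemma normal_peak1_le : 2 * normal_peak 1 <= 95 / 119 :> R.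
Proof.
rewrite -(@ler_pXn2r _ 2)// ?nnegrE ?mulr_ge0 ?normal_peak_ge0//.
rewrite exprMn /normal_peak expr1n mul1r exprVn sqr_sqrtr; last first.
  by rewrite mulrn_wge0// pi_ge0.
have := @pi_ge R => p; have p0 := pi_gt0 R.
rewrite -(mulr_natr pi) ler_pdivrMr ?mulr_gt0//; lra.
Qed.

Lemma std_normal_pdf_le (x : R) : normal_pdf 0 1 x <=
  normal_peak 1 * (1 - x ^+ 2 / 2 + x ^+ 4 / 8 - x ^+ 6 / 48 + x ^+ 8 / 384).
Proof.
rewrite std_normal_pdfE ler_wpM2l ?normal_peak_ge0//.
have x0 : 0 <= x ^+ 2 / 2 by rewrite divr_ge0 ?sqr_ge0.
by apply: le_trans (expRN_le_taylor4 x0) _; lra.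
Qed.

Local Open Scope ereal_scope.

(** The polynomial bound on the density is integrated over [[- a, a]]; [q] is its odd
    antiderivative, which explains the factor 2. *)
Lemma std_normal_center_le (a : R) : (0 < a)%R ->
  gamma [set x | `|x| < a]%R <=
  (2 * normal_peak 1 *
   (a - a ^+ 3 / 6 + a ^+ 5 / 40 - a ^+ 7 / 336 + a ^+ 9 / 3456))%:E.
Proof.
move=> a0.
pose q : {poly R} := (normal_peak 1 *:
  ('X - 6^-1 *: 'X^3 + 40^-1 *: 'X^5 - 336^-1 *: 'X^7 + 3456^-1 *: 'X^9))%R.
have mq : measurable_fun [set: R] (horner q^`()).
  by apply: continuous_measurable_fun; exact: continuous_horner.
have qE x : (q^`().[x] = normal_peak 1 *
    (1 - x ^+ 2 / 2 + x ^+ 4 / 8 - x ^+ 6 / 48 + x ^+ 8 / 384))%R.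
  rewrite /q !(derivZ, derivB, derivD, derivX, derivXn).
  rewrite !(hornerZ, hornerD, hornerN, hornerMn, hornerXn, hornerC).
  by field.
apply: (@le_trans _ _ (\int[mu]_(x in `[(- a)%R, a]) (q^`().[x])%:E)).
  apply: (@le_trans _ _ (gamma `[(- a)%R, a])).
    apply: le_measure; rewrite ?inE//.
      rewrite (_ : [set _ | _] = `](- a)%R, a[%classic)//.
      by apply/seteqP; split => x /=; rewrite in_itv/= ltr_norml.
    by move=> x /=; rewrite in_itv/= ltr_norml => /andP[? ?]; rewrite !ltW.
  apply: ge0_le_integral => //=.
  - by move=> x _; rewrite lee_fin normal_pdf_ge0.
  - by apply/measurable_EFinP; apply: measurable_funTS; exact: measurable_normal_pdf.
  - by apply/measurable_EFinP; exact: measurable_funTS mq.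
  - by move=> x _; rewrite lee_fin qE std_normal_pdf_le.
rewrite (@continuous_FTC2 _ _ (horner q)); last 4 first.
- by rewrite gtrN.
- by apply: continuous_subspaceT; exact: continuous_horner.
- split.
  + by move=> x _; exact: derivable_horner.
  + by apply: cvg_at_right_filter; exact: continuous_horner.
  + by apply: cvg_at_left_filter; exact: continuous_horner.
- by move=> x _; rewrite derive1E; apply: derive_val.
rewrite -EFinB lee_fin /q !(hornerZ, hornerD, hornerN, hornerX, hornerXn).
by rewrite le_eqVlt; apply/orP; left; apply/eqP; field.
Qed.

(* [2.35] exceeds the minimum over [t] of [sqrt (2 / pi) / (t * gamma {x | t <= |x|})]
   by about 0.1% only; the bounds on [pi] and on the integral must be this sharp. *)
Lemma std_normal_tail_ge : (2 * normal_peak 1)%:E <=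
  (235%:R / 100%:R * (3 / 4))%:E * gamma [set x | 3 / 4 <= `|x|]%R.
Proof.
have t0 : (0 < 3 / 4 :> R)%R by lra.
have -> : [set x : R | (3 / 4 <= `|x|)%R] = ~` [set x | `|x| < 3 / 4]%R.
  by apply/seteqP; split => x /=; rewrite leNgt => /negP.
have mS : measurable [set x : R | `|x| < 3 / 4]%R.
  rewrite (_ : [set _ | _] = `](- (3 / 4))%R, (3 / 4)%R[%classic)//.
  by apply/seteqP; split => x /=; rewrite in_itv/= ltr_norml.
rewrite probability_setC//.
have := std_normal_center_le t0.
have fin : gamma [set x | `|x| < 3 / 4]%R \is a fin_num by exact: fin_num_measure.
set g := fine (gamma [set x | `|x| < 3 / 4]%R).
rewrite [X in 1 - X](_ : _ = g%:E); last by rewrite fineK.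
rewrite -(fineK fin) -/g lee_fin => h.
rewrite -EFinB -EFinM lee_fin; have := normal_peak1_le.
by move: h; set k := (2 * normal_peak 1)%R; lra.
Qed.

End numeric.

(** * Independent normal families and iterated integrals *)

Section independence.
Context d (T : measurableType d) (R : realType) (P : probability T R).
Variables (I : finType) (X : I -> {RV P >-> R}).
Hypothesis indX : mutually_independent X.
Local Open Scope ereal_scope.

(** A family closed under intersection that generates the events determined by the variables other
    than [X a]. *)
Definition cylinders_off (a : I) : set (set T) :=
  [set C | exists2 B : I -> set R, (forall i, measurable (B i)) &
     C = \bigcap_(i in [set` [set~ a]%SET]) X i @^-1` B i].

Lemma measurable_RV_preimage (Y : {RV P >-> R}) (B : set R) : measurable B ->
  measurable (Y @^-1` B).
Proof. by move=> mB; rewrite -[X in measurable X]setTI; exact: measurable_funPT. Qed.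

Lemma cylinders_off_measurable a : cylinders_off a `<=` measurable.
Proof.
move=> _ [B mB ->]; apply: fin_bigcap_measurable => // i _.
exact: measurable_RV_preimage.
Qed.

Lemma cylinders_offI a : setI_closed (cylinders_off a).
Proof.
move=> _ _ [B mB ->] [B' mB' ->].
exists (fun i => B i `&` B' i); first by move=> i; exact: measurableI.
by rewrite -bigcapI; apply: eq_bigcapr => i _; rewrite preimage_setI.
Qed.

(** As functions of [C] both sides are finite measures; they agree on the cylinders, hence on the
    sigma-algebra these generate. *)
Lemma independent_off a (A C : set _) : measurable A ->
  <<s cylinders_off a >> C ->
  P (X a @^-1` A `&` C) = P (X a @^-1` A) * P C.
Proof.
move=> mA; have mXA := measurable_RV_preimage (X a) mA.
have finA : P (X a @^-1` A) \is a fin_num by exact: fin_num_measure.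
pose k : {nonneg R} := NngNum (fine_ge0 (measure_ge0 P (X a @^-1` A))).
rewrite setIC -[LHS]/(mrestr P mXA C).
rewrite (_ : P (X a @^-1` A) * P C = mscale k P C); last first.
  by rewrite /mscale/= fineK.
apply: (g_sigma_algebra_measure_unique (cylinders_off a) _ (fun=> setT)).
- exact: cylinders_off_measurable.
- by move=> _; exists (fun=> setT) => //; apply/esym; rewrite bigcapTP.
- by rewrite bigcup_const//; exists 0%N.
- exact: cylinders_offI.
- move=> _ [B mB ->].
  rewrite -[LHS]/(P (_ `&` X a @^-1` A)) -[RHS]/((fine _)%:E * P _) fineK//.
  (* Inserting [A] at index [a] turns the intersection into a cylinder over the whole index set, to
     which mutual independence applies. *)
  pose B' i := if i == a then A else B i.
  have mB' i : measurable (B' i) by rewrite /B'; case: ifP.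
  rewrite (indX [set~ a]%SET mB).
  rewrite (_ : _ `&` _ = \bigcap_(i in [set` [set: I]%SET]) X i @^-1` B' i).
    rewrite (indX [set: I]%SET mB') (bigD1 a) ?finset.in_setT//= {1}/B' eqxx.
    congr (_ * _); apply: eq_big => i.
      by rewrite finset.in_setT finset.in_setC finset.in_set1.
    by move=> /andP[_ ia]; rewrite /B' (negbTE ia).
  apply/seteqP; split => [t [Bt At] i _|t Bt].
    rewrite /B' /=; case: eqVneq => [->//|ia].
    by apply: Bt => /=; rewrite finset.in_setC finset.in_set1.
  split => [i /=|]; last first.
    by have := Bt a; rewrite /B' /= eqxx; apply; rewrite finset.in_setT.
  rewrite finset.in_setC finset.in_set1 => ia; have := Bt i; rewrite /B' /= (negbTE ia).
  by apply; rewrite finset.in_setT.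
- by move=> _; rewrite -[ltLHS]/(P (_ `&` _)) setTI ltey_eq finA.
Qed.

(** The sample space [T] with a coarser sigma-algebra. It plays the part of the space of all
    coordinates but [a], so that no measurable structure on [I -> R] is called for. *)
Definition gmeas_off (a : I) := g_sigma_algebraType (cylinders_off a).

Lemma measurable_to_off a : measurable_fun [set: T] (id : T -> gmeas_off a).
Proof.
move=> _ B mB; rewrite setTI preimage_id.
have : smallest (sigma_algebra setT) (cylinders_off a) `<=` measurable.
  apply: smallest_sub; first exact: sigma_algebra_measurable.
  exact: cylinders_off_measurable.
exact.
Qed.

Lemma measurable_from_off a i : i != a ->
  measurable_fun [set: gmeas_off a] (X i : gmeas_off a -> R).
Proof.
move=> ia _ B mB; rewrite setTI; apply: sub_sigma_algebra.
exists (fun j => if j == i then B else setT); first by move=> j; case: ifP.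
apply/seteqP; split => t /=.
  by move=> Bt j /= _; case: eqVneq => [->|].
by move=> /(_ i) /=; rewrite finset.in_setC finset.in_set1 eqxx; exact.
Qed.
End independence.

Definition upd (R : Type) (I : eqType) (x : I -> R) (a : I) (u : R) : I -> R :=
  fun i => if i == a then u else x i.

(* Joint measurability of [F] in a parameter and finitely many real variables,
   expressed without putting a sigma-algebra on [I -> R]. *)
Definition fam_measurable (R : realType) d (T : measurableType d) (I : Type)
    (F : T -> (I -> R) -> \bar R) : Prop :=
  forall d' (S : measurableType d') (tau : S -> T) (g : S -> I -> R),
    measurable_fun setT tau -> (forall i, measurable_fun setT (g^~ i)) ->
    measurable_fun setT (fun s => F (tau s) (g s)).

Section iterated_integral.
Context {R : realType}.
Local Notation gamma := (normal_prob (0 : R) 1).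
Local Open Scope ereal_scope.

Lemma updE (I : eqType) (x : I -> R) a u : upd x a u a = u.
Proof. by rewrite /upd eqxx. Qed.

Lemma upd_neq (I : eqType) (x : I -> R) a u i : i != a -> upd x a u i = x i.
Proof. by rewrite /upd => /negbTE ->. Qed.

Lemma measurable_upd d (S : measurableType d) (I : eqType) (g : S -> I -> R)
    (a : I) (u : S -> R) :
  (forall i, measurable_fun setT (g^~ i)) -> measurable_fun setT u ->
  forall i, measurable_fun setT (fun s => upd (g s) a (u s) i).
Proof. by move=> mg mu i; rewrite /upd; case: eqVneq. Qed.

Definition gint (I : eqType) (a : I) (F : (I -> R) -> \bar R) (x : I -> R) : \bar R :=
  \int[gamma]_u F (upd x a u).

(** The head of [s] is the outermost integral; coordinates off [s] keep their values in the
    argument. *)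
Definition gints (I : eqType) (s : seq I) (F : (I -> R) -> \bar R) :=
  foldr (@gint I) F s.

Section param.
Context d (T : measurableType d) (I : eqType).
Implicit Types (F G : T -> (I -> R) -> \bar R).

Lemma gint_ge0 (a : I) (F : (I -> R) -> \bar R) x :
  (forall y, 0 <= F y) -> 0 <= gint a F x.
Proof. by move=> F0; apply: integral_ge0. Qed.

Lemma gints_ge0 (s : seq I) (F : (I -> R) -> \bar R) :
  (forall y, 0 <= F y) -> forall x, 0 <= gints s F x.
Proof. by move=> F0; elim: s => //= a s IH x; exact: gint_ge0. Qed.

Lemma fam_measurable_gint a F : fam_measurable F -> (forall t x, 0 <= F t x) ->
  fam_measurable (fun t => gint a (F t)).
Proof.
move=> mF F0 d' S tau g mtau mg.
pose f (z : S * measurableTypeR R) := F (tau z.1) (upd (g z.1) a z.2).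
apply: (@measurable_fun_fubini_tonelli_F _ _ S (measurableTypeR R) R gamma f) => [|z].
  apply: mF; first exact: measurableT_comp.
  by apply: measurable_upd => // i; exact: (measurableT_comp (mg i) measurable_fst).
exact: F0.
Qed.

Lemma fam_measurable_gints s F : fam_measurable F -> (forall t x, 0 <= F t x) ->
  fam_measurable (fun t => gints s (F t)).
Proof.
move=> mF F0; elim: s => //= a s IH.
by apply: fam_measurable_gint => // t x; apply: gints_ge0.
Qed.

Lemma fam_measurable_point F t x a : fam_measurable F ->
  measurable_fun setT (fun u => F t (upd x a u)).
Proof. by move=> mF; apply: mF => //; apply: measurable_upd. Qed.

Lemma le_gint a F G t x : fam_measurable F -> fam_measurable G ->
  (forall t x, 0 <= F t x) -> (forall x, F t x <= G t x) ->
  gint a (F t) x <= gint a (G t) x.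
Proof.
move=> mF mG F0 FG; apply: ge0_le_integral => //.
- exact: (fam_measurable_point t x a mF).
- exact: (fam_measurable_point t x a mG).
Qed.

Lemma le_gints s F G t x : fam_measurable F -> fam_measurable G ->
  (forall t x, 0 <= F t x) -> (forall t x, 0 <= G t x) ->
  (forall x, F t x <= G t x) ->
  gints s (F t) x <= gints s (G t) x.
Proof.
move=> mF mG F0 G0 FG; elim: s x => //= a s IH x.
apply: (@le_gint a (fun t => gints s (F t)) (fun t => gints s (G t))) => //.
- exact: fam_measurable_gints.
- exact: fam_measurable_gints.
- by move=> *; exact: gints_ge0.
Qed.

Lemma integral_gint (mu : {sigma_finite_measure set T -> \bar R}) a F x :
  fam_measurable F -> (forall t x, 0 <= F t x) ->
  \int[mu]_t gint a (F t) x = gint a (fun y => \int[mu]_t F t y) x.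
Proof.
move=> mF F0; pose f (z : T * measurableTypeR R) := F z.1 (upd x a z.2).
apply: (@fubini_tonelli _ _ _ _ R mu gamma f) => [|z]; last exact: F0.
by apply: mF => //; apply: measurable_upd.
Qed.

Lemma integral_gints (mu : {sigma_finite_measure set T -> \bar R}) s F x :
  fam_measurable F -> (forall t x, 0 <= F t x) ->
  \int[mu]_t gints s (F t) x = gints s (fun y => \int[mu]_t F t y) x.
Proof.
move=> mF F0; elim: s x => //= a s IH x.
rewrite integral_gint//; last by move=> *; exact: gints_ge0.
  by congr (gint a _ x); apply/funext => y; exact: IH.
exact: fam_measurable_gints.
Qed.

End param.
End iterated_integral.

Section resample.
Context d (T : measurableType d) (R : realType) (P : probability T R).
Local Notation gamma := (normal_prob (0 : R) 1).
Local Open Scope ereal_scope.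

Definition iid_std_normal (I : finType) (X : I -> {RV P >-> R}) : Prop :=
  (forall i (B : set R), measurable B -> distribution P (X i) B = gamma B) /\
  mutually_independent X.

Definition sample (I : finType) (X : I -> {RV P >-> R}) (t : T) : I -> R :=
  fun i => X i t.

Context (I : finType) (X : I -> {RV P >-> R}).
Hypothesis iidX : iid_std_normal X.
Context d0 (T0 : measurableType d0).

(** By independence the pair formed by [X a] and the identity onto [gmeas_off X a] has a product
    law. Tonelli then integrates out the first factor, with law [gamma], while the second still
    determines every other coordinate. *)
Lemma integral_resample (a : I) (F : T0 -> (I -> R) -> \bar R) t0 :
  fam_measurable F -> (forall t x, 0 <= F t x) ->
  \int[P]_t F t0 (sample X t) = \int[P]_t gint a (F t0) (sample X t).
Proof.
case: iidX => dX indX mF F0.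
have mid : measurable_fun [set: T] (id : T -> gmeas_off X a).
  exact: measurable_to_off.
pose idM := isMeasurableFun.Build _ _ _ _ _ mid.
pose toS : {mfun T >-> gmeas_off X a} := HB.pack (id : T -> gmeas_off X a) idM.
pose PS := distribution P toS.
pose J t : measurableTypeR R * gmeas_off X a := (X a t, t).
have mJ : measurable_fun setT J.
  by apply/measurable_fun_pairP; split; [exact: (@measurable_funPT _ _ _ _ (X a))|exact: mid].
pose f (z : measurableTypeR R * gmeas_off X a) := F t0 (upd (sample X z.2) a z.1).
have mf : measurable_fun setT f.
  apply: mF => // i; rewrite /upd; case: eqVneq => [_|ia]; first exact: measurable_fst.
  have h := @measurable_from_off _ _ _ _ _ X _ _ ia.
  exact (measurableT_comp h (@measurable_snd _ _ (measurableTypeR R) (gmeas_off X a))).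
have f0 z : 0 <= f z by exact: F0.
pose PJ := measure_function_pushforward__canonical__measure_function_Measure P mJ.
transitivity (\int[PJ]_z f z).
  rewrite ge0_integral_pushforward//; apply: eq_integral => t _ /=.
  rewrite /f /J/=; congr F; apply/funext => i; rewrite /upd.
  by case: eqVneq => [->|].
transitivity (\int[gamma \x PS]_z f z).
  apply: eq_measure_integral => A mA _; apply/esym.
  apply: (@product_measure_unique _ _ (measurableTypeR R) (gmeas_off X a) R
    gamma PS PJ) => // B C mB mC.
  rewrite -[LHS]/(P (X a @^-1` B `&` C)) (independent_off indX)//.
  by congr (_ * _); exact: dX.
rewrite (@fubini_tonelli2 _ _ (measurableTypeR R) (gmeas_off X a) R gamma PS)//.
rewrite ge0_integral_distribution//.
- exact: measurable_fun_fubini_tonelli_G.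
- by move=> z; apply: integral_ge0.
Qed.

Lemma integral_resamples (s : seq I) (F : T0 -> (I -> R) -> \bar R) t0 :
  fam_measurable F -> (forall t x, 0 <= F t x) ->
  \int[P]_t F t0 (sample X t) = \int[P]_t gints s (F t0) (sample X t).
Proof.
move=> mF F0; elim: s => //= a s ->.
apply: (@integral_resample a (fun t => gints s (F t))).
- exact: fam_measurable_gints.
- by move=> *; exact: gints_ge0.
Qed.

End resample.

(** * Linear forms in normal variables and rotation invariance *)

Section gaussian_linear.
Context {R : realType}.
Local Notation gamma := (normal_prob (0 : R) 1).
Local Open Scope ereal_scope.

Lemma std_normal_integral_cst (r : \bar R) : \int[gamma]_x r = r.
Proof.
rewrite integral_cst//= [X in _ * X](_ : _ = 1) ?mule1//.
exact: (probability_setT (normal_prob (0 : R) 1)).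
Qed.

Section linear2.
Variables (h : R -> \bar R).
Hypotheses (mh : measurable_fun setT h) (h0 : forall x, 0 <= h x).

Let mhl (a b c : R) :
  measurable_fun setT (fun z : R * R => h (b + (a * z.1 + c * z.2))%R).
Proof.
apply: (measurableT_comp mh) => //; apply: measurable_funD => //.
by apply: measurable_funD; apply: measurable_funM.
Qed.

(** A quarter turn exchanges a coordinate with the opposite of the other. This supplies the
    reflection needed when the rotation formula excludes [c = -1]. *)
Lemma std_normal_integral_sym (b a : R) :
  \int[gamma]_x h (b + - a * x)%R = \int[gamma]_x h (b + a * x)%R.
Proof.
have cs : (0 ^+ 2 + 1 ^+ 2 = 1 :> R)%R by rewrite expr0n expr1n add0r.
have c1 : (0 != -1 :> R)%R by rewrite eq_sym oppr_eq0 oner_neq0.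
transitivity (\int[gamma]_x \int[gamma]_y h (b + (0 * x + a * y))%R).
  have <- := ge0_integral_std_normal_rotation
    (f := fun x y => h (b + (0 * x + a * y))%R) (mhl 0 b a) (fun _ _ => h0 _) cs c1.
  apply: eq_integral => x _; rewrite -[LHS]std_normal_integral_cst.
  by apply: eq_integral => y _; congr h; ring.
under eq_integral do under eq_integral do rewrite mul0r add0r.
by rewrite std_normal_integral_cst.
Qed.

(** The form [a * x + c * y] is [r] times the first coordinate after the rotation of cosine [a / r]
    and sine [c / r]. *)
Lemma std_normal_integral_linear2 (b a c : R) :
  \int[gamma]_x \int[gamma]_y h (b + (a * x + c * y))%R =
  \int[gamma]_x h (b + Num.sqrt (a ^+ 2 + c ^+ 2) * x)%R.
Proof.
set r := Num.sqrt _.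
have r2 : (r ^+ 2 = a ^+ 2 + c ^+ 2)%R by rewrite sqr_sqrtr// addr_ge0 ?sqr_ge0.
have [r0|r0] := eqVneq r 0%R.
  move/eqP : r2; rewrite r0 expr0n/= eq_sym paddr_eq0 ?sqr_ge0// !sqrf_eq0.
  move=> /andP[/eqP -> /eqP ->]; apply: eq_integral => x _.
  rewrite -[RHS]std_normal_integral_cst; apply: eq_integral => y _.
  by congr h; ring.
have cs : ((a / r) ^+ 2 + (c / r) ^+ 2 = 1)%R.
  by rewrite !expr_div_n -mulrDl -r2 divff// expf_neq0.
have [ar|ar] := eqVneq (a / r)%R (-1)%R.
  have c0 : c = 0%R.
    move: cs; rewrite ar sqrrN expr1n => /eqP; rewrite -subr_eq0 addrAC subrr add0r.
    by rewrite sqrf_eq0 mulf_eq0 invr_eq0 (negbTE r0) orbF => /eqP.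
  have -> : a = (- r)%R by rewrite -[a](divfK r0) ar mulN1r.
  rewrite -std_normal_integral_sym c0; apply: eq_integral => x _.
  rewrite -[RHS]std_normal_integral_cst; apply: eq_integral => y _.
  by congr h; ring.
transitivity (\int[gamma]_x \int[gamma]_y h (b + (r * x + 0 * y))%R); last first.
  apply: eq_integral => x _.
  rewrite -[RHS]std_normal_integral_cst; apply: eq_integral => y _.
  by congr h; ring.
have <- := ge0_integral_std_normal_rotation
  (f := fun x y => h (b + (r * x + 0 * y))%R) (mhl r b 0) (fun _ _ => h0 _) cs ar.
apply: eq_integral => x _; apply: eq_integral => y _.
by congr h; field.
Qed.

End linear2.

(** A linear form in independent standard normal variables is normal, its deviation being the norm
    of the coefficients. The hypothesis on [F] concerns only points that agree with [x] off [s]: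
    thus [u], [b] and [h] may depend on the coordinates held fixed, as the cofactors will. *)
Lemma gints_linear (I : eqType) (s : seq I) (u : I -> R) (F : (I -> R) -> \bar R)
    (h : R -> \bar R) (b : R) (x : I -> R) :
  uniq s -> measurable_fun setT h -> (forall y, 0 <= h y) ->
  (forall y, (forall i, i \notin s -> y i = x i) ->
    F y = h (b + \sum_(i <- s) u i * y i)%R) ->
  gints s F x =
  \int[gamma]_v h (b + Num.sqrt (\sum_(i <- s) u i ^+ 2) * v)%R.
Proof.
move=> + mh h0; elim: s b x => [|a s IH] b x /=.
  move=> _ Fh; rewrite (Fh x)// !big_nil sqrtr0.
  by under eq_integral do rewrite mul0r; rewrite std_normal_integral_cst.
move=> /andP[aNs us] Fh; rewrite big_cons.
have S0 : (0 <= \sum_(i <- s) u i ^+ 2)%R by apply: sumr_ge0 => i _; exact: sqr_ge0.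
rewrite -[in RHS](sqr_sqrtr S0) -std_normal_integral_linear2//.
apply: eq_integral => v _; rewrite (IH (b + u a * v)%R)//.
  by apply: eq_integral => w _; rewrite addrA.
move=> y yx; rewrite Fh; last first.
  move=> i; rewrite in_cons negb_or => /andP[ia iNs].
  by rewrite yx// upd_neq.
by rewrite big_cons yx// updE addrA.
Qed.

End gaussian_linear.

Definition rot (R : pzRingType) (I : eqType) (a b : I) (c s : R) (x : I -> R) : I -> R :=
  upd (upd x a (c * x a + s * x b)) b (c * x b - s * x a).

Definition row_rot (R : pzRingType) (p m : nat) (a b : 'I_p) (c s : R)
    (ks : seq 'I_m) (x : 'I_p * 'I_m -> R) : 'I_p * 'I_m -> R :=
  foldr (fun k y => rot (a, k) (b, k) c s y) x ks.

Section rotation_invariance.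
Context d (T : measurableType d) (R : realType) (P : probability T R).
Local Notation gamma := (normal_prob (0 : R) 1).
Local Open Scope ereal_scope.

Lemma fam_measurable_rot d0 (T0 : measurableType d0) (I : eqType) (a b : I) (c s : R)
    (F : T0 -> (I -> R) -> \bar R) :
  fam_measurable F -> fam_measurable (fun t x => F t (rot a b c s x)).
Proof.
move=> mF d' S tau g mtau mg; apply: mF => //.
apply: measurable_upd; first apply: measurable_upd => //.
- by apply: measurable_funD; apply: measurable_funM.
- by apply: measurable_funB; apply: measurable_funM.
Qed.

Section single.
Context (I : finType) (X : I -> {RV P >-> R}).
Hypothesis iidX : iid_std_normal X.

(** Resampling the coordinates [a] and [b] on both sides leaves a double integral, to which the
    planar formula applies. *)
Lemma integral_rot d0 (T0 : measurableType d0) (a b : I) (c s : R)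
    (F : T0 -> (I -> R) -> \bar R) t0 : a != b ->
  (c ^+ 2 + s ^+ 2 = 1)%R -> (c != -1)%R ->
  fam_measurable F -> (forall t x, 0 <= F t x) ->
  \int[P]_t F t0 (rot a b c s (sample X t)) = \int[P]_t F t0 (sample X t).
Proof.
move=> ab cs1 c1 mF F0.
rewrite [RHS](integral_resamples iidX [:: a; b])//.
transitivity (\int[P]_t gints [:: a; b]
    (fun x => F t0 (rot a b c s x)) (sample X t)).
  apply: (integral_resamples iidX _ (F := fun t x => F t (rot a b c s x))) => //.
  exact: fam_measurable_rot.
apply: eq_integral => t _ /=; set x := sample X t.
pose f u v := F t0 (upd (upd x a u) b v).
rewrite -[RHS]/(\int[gamma]_u \int[gamma]_v f u v).
have mf : measurable_fun setT (fun z : R * R => f z.1 z.2).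
  by apply: mF => //; apply: measurable_upd => //; apply: measurable_upd.
have <- := ge0_integral_std_normal_rotation mf (fun _ _ => F0 _ _) cs1 c1.
apply: eq_integral => u _; apply: eq_integral => v _; rewrite /f.
congr F; apply/funext => i; rewrite /rot /upd eqxx (negbTE ab) eqxx.
by case: eqVneq => // _; case: eqVneq.
Qed.

End single.

Lemma integral_row_rot (p m : nat) (X : 'I_p * 'I_m -> {RV P >-> R})
    d0 (T0 : measurableType d0) (a b : 'I_p) (c s : R) (ks : seq 'I_m)
    (F : T0 -> ('I_p * 'I_m -> R) -> \bar R) t0 :
  iid_std_normal X -> a != b ->
  (c ^+ 2 + s ^+ 2 = 1)%R -> (c != -1)%R ->
  fam_measurable F -> (forall t x, 0 <= F t x) ->
  \int[P]_t F t0 (row_rot a b c s ks (sample X t)) = \int[P]_t F t0 (sample X t).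
Proof.
move=> iidX ab cs1 c1 + F0; elim: ks F F0 => //= k ks IH F F0 mF.
transitivity (\int[P]_t F t0 (rot (a, k) (b, k) c s (sample X t))).
  apply: (IH (fun t x => F t (rot (a, k) (b, k) c s x))) => //.
  exact: fam_measurable_rot.
by apply: integral_rot => //; rewrite xpair_eqE (negbTE ab).
Qed.

End rotation_invariance.

(** * Random linear systems *)

Section measurable_matrix.
Context d (S : measurableType d) (R : realType).

Lemma measurable_bool_natr (b : S -> bool) : measurable_fun setT b ->
  measurable_fun setT (fun s => ((b s)%:R : R)%:E).
Proof. by move=> mb; exact: (measurableT_comp (f := fun c : bool => (c%:R : R)%:E)). Qed.

Lemma integral_bool_natr (mu : {measure set S -> \bar R}) (b : S -> bool) :
  measurable_fun setT b ->
  (\int[mu]_s ((b s)%:R : R)%:E = mu [set s | b s])%E.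
Proof.
move=> mb; have mS : measurable [set s | b s].
  by have := mb measurableT [set true] I; rewrite setTI preimage_true.
transitivity (\int[mu]_s (\1_[set s | b s] s)%:E)%E; last by rewrite integral_indic// setIT.
apply: eq_integral => s _; rewrite indicE; congr (_%:R%:E).
by congr nat_of_bool; apply/idP/idP; rewrite inE.
Qed.

Lemma measurable_det p (A : S -> 'M[R]_p) :
  (forall i j, measurable_fun setT (fun s => A s i j)) ->
  measurable_fun setT (fun s => \det (A s)).
Proof.
move=> mA; apply: measurable_sum => sg; apply: measurable_funM => //.
apply: measurable_prod => i _; exact: mA.
Qed.

Lemma measurable_adj p (A : S -> 'M[R]_p) i j :
  (forall i j, measurable_fun setT (fun s => A s i j)) ->
  measurable_fun setT (fun s => (\adj (A s)) i j).
Proof.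
move=> mA; under eq_fun do rewrite mxE /cofactor.
apply: measurable_funM => //; apply: measurable_det => k l.
by under eq_fun do rewrite !mxE; exact: mA.
Qed.

Lemma measurable_mulmx p q r (A : S -> 'M[R]_(p, q)) (B : S -> 'M[R]_(q, r)) i j :
  (forall i j, measurable_fun setT (fun s => A s i j)) ->
  (forall i j, measurable_fun setT (fun s => B s i j)) ->
  measurable_fun setT (fun s => (A s *m B s) i j).
Proof.
move=> mA mB; under eq_fun do rewrite mxE.
by apply: measurable_sum => k; exact: measurable_funM.
Qed.

Lemma measurable_norm2 p (v : S -> 'cV[R]_p) :
  (forall i, measurable_fun setT (fun s => v s i 0)) ->
  measurable_fun setT (fun s => norm2 (v s)).
Proof.
move=> mv; apply: (measurableT_comp (f := @Num.sqrt R)).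
  by apply: continuous_measurable_fun; exact: sqrt_continuous.
by apply: measurable_sum => i; exact: measurable_funX.
Qed.
End measurable_matrix.

Section solution_exceeds.
Context {R : realType}.

(* Excluding singular [A] makes this invariant under multiplication of [A] and [v]
   by an invertible matrix; that [A] is almost surely invertible is shown apart. *)
Definition solution_exceeds p (z : R) (A : 'M[R]_p) (v : 'cV[R]_p) : bool :=
  (A \in unitmx) && (z < norm2 (invmx A *m v)).

(** Clearing the determinant removes the inverse and expresses the event through polynomials in the
    entries; measurability follows from this form. *)
Lemma solution_exceeds_adj p z (A : 'M[R]_p) v :
  solution_exceeds z A v =
  (\det A != 0) && (`|\det A| * z < norm2 (\adj A *m v)).
Proof.
rewrite /solution_exceeds unitmxE unitfE; have [//|d0 /=] := eqVneq (\det A) 0.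
rewrite /invmx unitmxE unitfE d0 -scalemxAl norm2Z normfV.
by rewrite ltr_pdivlMl ?normr_gt0.
Qed.

Lemma measurable_solution_exceeds d (S : measurableType d) p z
    (A : S -> 'M[R]_p) (v : S -> 'cV[R]_p) :
  (forall i j, measurable_fun setT (fun s => A s i j)) ->
  (forall i, measurable_fun setT (fun s => v s i 0)) ->
  measurable_fun setT (fun s => solution_exceeds z (A s) (v s)).
Proof.
move=> mA mv; have md := measurable_det mA.
under eq_fun do rewrite solution_exceeds_adj.
apply: measurable_and.
  by apply: measurable_neg; exact: measurable_fun_eqr.
apply: measurable_fun_ltr.
  by apply: measurable_funM => //; exact: measurableT_comp.
apply: measurable_norm2 => i; apply: measurable_mulmx => k l.
  exact: measurable_adj.
by rewrite ord1; exact: mv.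
Qed.

Lemma solution_exceeds_mul p z (Q A : 'M[R]_p) v : Q \in unitmx ->
  solution_exceeds z (Q *m A) (Q *m v) = solution_exceeds z A v.
Proof.
move=> uQ; rewrite /solution_exceeds unitmx_mul uQ /=.
case: (boolP (A \in unitmx)) => //= uA; congr (_ < norm2 _).
suff -> : Q *m v = (Q *m A) *m (invmx A *m v) by rewrite mulKmx ?unitmx_mul ?uQ.
by rewrite -!mulmxA mulKVmx.
Qed.

Lemma solution_exceeds_axis p z (A : 'M[R]_p.+1) (v : 'cV[R]_p.+1) :
  (forall i, i != ord0 -> v i 0 = 0) ->
  solution_exceeds z A v =
  (\det A != 0) && (`|\det A| * z < norm2 v * norm2 (\col_j cofactor A ord0 j)).
Proof.
move=> v0; rewrite solution_exceeds_adj; congr (_ && (_ < _)).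
have -> : \adj A *m v = v ord0 0 *: \col_j cofactor A ord0 j.
  apply/matrixP => i k; rewrite ord1 !mxE (bigD1 ord0)//= big1 ?addr0.
    by rewrite mxE mulrC.
  by move=> j j0; rewrite v0// mulr0.
rewrite norm2Z; congr (_ * _); rewrite /norm2 (bigD1 ord0)//= big1 ?addr0 ?sqrtr_sqr//.
by move=> j j0; rewrite v0// expr0n.
Qed.

End solution_exceeds.

Definition givens (R : pzRingType) p (a b : 'I_p) (c s : R) : 'M[R]_p :=
  \matrix_(i, j) if i == a then c * (j == a)%:R + s * (j == b)%:R
                 else if i == b then c * (j == b)%:R - s * (j == a)%:R
                 else (j == i)%:R.

Definition mx_of_fam (R : Type) p m (x : 'I_p * 'I_m -> R) : 'M[R]_(p, m) :=
  \matrix_(i, j) x (i, j).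

Section givens.
Context {R : realType}.

Lemma sum_delta p (a : 'I_p) (f : 'I_p -> R) : \sum_j (j == a)%:R * f j = f a.
Proof.
rewrite (bigD1 a)//= eqxx mul1r big1 ?addr0// => j /negbTE ->.
by rewrite mul0r.
Qed.

Lemma givens_mulE p q (a b : 'I_p) (c s : R) (A : 'M[R]_(p, q)) i k :
  (givens a b c s *m A) i k =
  if i == a then c * A a k + s * A b k
  else if i == b then c * A b k - s * A a k else A i k.
Proof.
have lin (u v : R) (e f : 'I_p) :
    \sum_j (u * (j == e)%:R + v * (j == f)%:R) * A j k = u * A e k + v * A f k.
  under eq_bigr do rewrite mulrDl -!mulrA.
  by rewrite big_split/= -!mulr_sumr !(sum_delta _ (A^~ k)).
rewrite mxE; under eq_bigr do rewrite mxE.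
case: eqVneq => _; first exact: lin.
case: eqVneq => _; last exact: (sum_delta _ (A^~ k)).
by rewrite -mulNr -lin; apply: eq_bigr => j _; rewrite mulNr.
Qed.

Lemma givens_unit p (a b : 'I_p) (c s : R) : a != b -> c ^+ 2 + s ^+ 2 = 1 ->
  givens a b c s \in unitmx.
Proof.
move=> ab cs; suff /mulmx1_unit[] : givens a b c (- s) *m givens a b c s = 1%:M by [].
apply/matrixP => i k; rewrite givens_mulE !mxE !eqxx (eq_sym b a) (negbTE ab).
have [->|ia] := eqVneq i a.
  rewrite (eq_sym a k).
  transitivity ((c ^+ 2 + s ^+ 2) * (k == a)%:R); first by ring.
  by rewrite cs mul1r.
have [->|ib] := eqVneq i b; last by rewrite eq_sym.
rewrite (eq_sym b k).
transitivity ((c ^+ 2 + s ^+ 2) * (k == b)%:R); first by ring.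
by rewrite cs mul1r.
Qed.

Lemma norm2_givens p (a b : 'I_p) (c s : R) (v : 'cV[R]_p) : a != b ->
  c ^+ 2 + s ^+ 2 = 1 -> norm2 (givens a b c s *m v) = norm2 v.
Proof.
move=> ab cs; rewrite /norm2; congr Num.sqrt.
rewrite (bigD1 a)//= [RHS](bigD1 a)//= (bigD1 b) 1?eq_sym//= [in RHS](bigD1 b) 1?eq_sym//=.
rewrite !givens_mulE !eqxx (eq_sym b a) (negbTE ab) !addrA; congr (_ + _).
  transitivity ((c ^+ 2 + s ^+ 2) * (v a 0 ^+ 2 + v b 0 ^+ 2)); first by ring.
  by rewrite cs mul1r.
by apply: eq_bigr => i /andP[/negbTE ia /negbTE ib]; rewrite givens_mulE ia ib.
Qed.

Lemma row_rotE p m (a b : 'I_p) (c s : R) (ks : seq 'I_m) x i k : a != b ->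
  uniq ks ->
  row_rot a b c s ks x (i, k) =
  if k \in ks then
    if i == a then c * x (a, k) + s * x (b, k)
    else if i == b then c * x (b, k) - s * x (a, k) else x (i, k)
  else x (i, k).
Proof.
move=> ab; elim: ks i k => //= k0 ks IH i k /andP[k0ks uks].
rewrite /rot /upd !xpair_eqE in_cons !IH// (negbTE k0ks).
have [->|kk0] := eqVneq k k0; last by rewrite !andbF.
rewrite !andbT/= (negbTE k0ks).
have [->|ia] := eqVneq i a; last by [].
by rewrite (negbTE ab).
Qed.

Lemma mx_of_row_rot p m (a b : 'I_p) (c s : R) (x : 'I_p * 'I_m -> R) : a != b ->
  mx_of_fam (row_rot a b c s (enum 'I_m) x) = givens a b c s *m mx_of_fam x.
Proof.
move=> ab; apply/matrixP => i k.
by rewrite givens_mulE !mxE row_rotE ?enum_uniq// mem_enum.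
Qed.

End givens.

(** * Conditioning on all rows but the first *)

Section exceedance.
Context d (T : measurableType d) (R : realType) (P : probability T R).
Local Notation gamma := (normal_prob (0 : R) 1).
Local Open Scope ereal_scope.
Context (p m : nat) (X : 'I_p * 'I_m -> {RV P >-> R}).
Hypothesis iidX : iid_std_normal X.
Variable N : 'M[R]_(m, p).

Definition exceeds_ind (z : R) (B : 'M[R]_p) (v : 'cV[R]_p)
    (x : 'I_p * 'I_m -> R) : \bar R :=
  (solution_exceeds z (B + mx_of_fam x *m N)%R v)%:R%:E.

Lemma measurable_affine_mx d' (S : measurableType d') (g : S -> 'I_p * 'I_m -> R)
    (B : 'M[R]_p) i j :
  (forall k, measurable_fun setT (g^~ k)) ->
  measurable_fun setT (fun s => (B + mx_of_fam (g s) *m N)%R i j).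
Proof.
move=> mg; under eq_fun do rewrite mxE.
apply: measurable_funD => //; apply: measurable_mulmx => k l //.
by under eq_fun do rewrite mxE; exact: mg.
Qed.

Lemma fam_measurable_exceeds (z : R) (B : 'M[R]_p) (v : 'cV[R]_p) :
  fam_measurable (fun _ : unit => exceeds_ind z B v).
Proof.
move=> d' S tau g _ mg; apply: measurable_bool_natr.
apply: measurable_solution_exceeds => // i j; exact: measurable_affine_mx.
Qed.

Lemma exceeds_ind_ge0 z B v x : 0 <= exceeds_ind z B v x.
Proof. by rewrite lee_fin. Qed.

(** With [Q] the rotation, [Q B + (Q Z) N = Q (B + Z N)], the factor [Q] cancels in the solution,
    and [Q Z] may replace [Z] under the integral. Since [B] is rotated along with [v], the estimates
    have to hold for every [B]. *)
Lemma integral_exceeds_givens z B v (a b : 'I_p) (c s : R) : a != b ->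
  (c ^+ 2 + s ^+ 2 = 1)%R -> (c != -1)%R ->
  \int[P]_t exceeds_ind z (givens a b c s *m B) (givens a b c s *m v) (sample X t) =
  \int[P]_t exceeds_ind z B v (sample X t).
Proof.
move=> ab cs c1.
have <- := @integral_row_rot _ _ _ _ _ _ X _ unit a b c s (enum 'I_m)
  (fun _ => exceeds_ind z (givens a b c s *m B) (givens a b c s *m v)) tt
  iidX ab cs c1 (fam_measurable_exceeds _ _ _) (fun _ => exceeds_ind_ge0 _ _ _).
apply: eq_integral => t _; rewrite /exceeds_ind mx_of_row_rot//.
rewrite -mulmxA -mulmxDr solution_exceeds_mul//.
exact: givens_unit.
Qed.

End exceedance.

Section first_row.
Context (R : realType) (p m : nat) (N : 'M[R]_(m, p.+1)) (B : 'M[R]_p.+1).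
Local Notation gamma := (normal_prob (0 : R) 1).
Implicit Types x y : 'I_p.+1 * 'I_m -> R.

Let A y : 'M[R]_p.+1 := B + mx_of_fam y *m N.

Definition cofactor_row0 (A : 'M[R]_p.+1) : 'cV[R]_p.+1 := \col_j cofactor A ord0 j.

Definition row0_indices : seq ('I_p.+1 * 'I_m) := [seq (ord0, k) | k <- enum 'I_m].

Lemma cofactor_row0_eq x y : (forall i, i \notin row0_indices -> y i = x i) ->
  cofactor_row0 (A y) = cofactor_row0 (A x).
Proof.
move=> yx; apply/matrixP => j k; rewrite !mxE /cofactor; congr (_ * \det _).
apply/matrixP => a b; rewrite !mxE; congr (_ + _); apply: eq_bigr => l _.
by rewrite !mxE yx//; apply/negP => /mapP[? _ []].
Qed.

Lemma det_row0 y : \det (A y) = \sum_c B ord0 c * cofactor_row0 (A y) c 0 +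
  \sum_(i <- row0_indices) (N *m cofactor_row0 (A y)) i.2 0 * y i.
Proof.
rewrite (expand_det_row _ ord0) big_map big_enum/=.
under eq_bigr do rewrite mxE mulrDl.
rewrite big_split/=; congr (_ + _); first by apply: eq_bigr => j _; rewrite mxE.
under eq_bigr do rewrite mxE mulr_suml.
rewrite exchange_big/=; apply: eq_bigr => k _.
rewrite [in RHS]mxE mulr_suml; apply: eq_bigr => j _.
by rewrite !mxE; ring.
Qed.

(** With the other rows fixed, the cofactor vector [C] is constant and the determinant is linear in
    the first row of the family, with coefficient vector [N C]: a normal variable of deviation
    [norm2 (N *m C)]. *)
Lemma gints_row0 (h : 'cV[R]_p.+1 -> R -> \bar R) x :
  (forall C, measurable_fun setT (h C)) -> (forall C w, (0 <= h C w)%E) ->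
  gints row0_indices (fun y => h (cofactor_row0 (A y)) (\det (A y))) x =
  (\int[gamma]_v h (cofactor_row0 (A x))
    (\sum_c B ord0 c * cofactor_row0 (A x) c 0 +
       norm2 (N *m cofactor_row0 (A x)) * v)%R)%E.
Proof.
move=> mh h0; set C := cofactor_row0 (A x).
rewrite (@gints_linear _ _ row0_indices (fun i => (N *m C) i.2 0) _ (h C)
  (\sum_c B ord0 c * C c 0) x)//.
- by rewrite big_map big_enum.
- by rewrite map_inj_uniq ?enum_uniq// => ? ? [].
- by move=> y yx; rewrite det_row0 (cofactor_row0_eq yx).
Qed.

End first_row.

Section anticoncentration.
Context d (T : measurableType d) (R : realType) (P : probability T R).
Local Notation gamma := (normal_prob (0 : R) 1).
Local Open Scope ereal_scope.

Section axis.
Context (p m : nat) (X : 'I_p.+1 * 'I_m -> {RV P >-> R}).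
Hypothesis iidX : iid_std_normal X.
Variables (N : 'M[R]_(m, p.+1)) (k : R).
Hypotheses (k_ge0 : (0 <= k)%R) (Nk : forall w, (norm2 w <= k * norm2 (N *m w))%R).

Lemma integral_exceeds_axis (z : R) (B : 'M[R]_p.+1) (v : 'cV[R]_p.+1) :
  (0 < z)%R -> (forall i, i != ord0 -> v i 0 = 0)%R ->
  \int[P]_t exceeds_ind N z B v (sample X t) <=
    (2 * normal_peak 1 * norm2 v * k / z)%:E.
Proof.
move=> z0 vaxis.
rewrite (integral_resamples iidX (row0_indices p m)
  (F := fun _ : unit => exceeds_ind N z B v) tt); last 2 first.
- exact: fam_measurable_exceeds.
- by move=> _ x; exact: exceeds_ind_ge0.
pose h (C : 'cV[R]_p.+1) (w : R) : \bar R :=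
  ((w != 0) && (`|w| * z < norm2 v * norm2 C))%R%:R%:E.
have mh C : measurable_fun setT (h C).
  apply: measurable_bool_natr; apply: measurable_and.
    by apply: measurable_neg; exact: measurable_fun_eqr.
  apply: measurable_fun_ltr => //; apply: measurable_funM => //.
have h0 C w : 0 <= h C w by rewrite lee_fin.
have bnd0 : (0 <= 2 * normal_peak 1 * norm2 v * k / z)%R.
  by rewrite divr_ge0 ?mulr_ge0 ?normal_peak_ge0 ?norm2_ge0// ltW.
rewrite -[leRHS]mule1 -(@probability_setT _ _ _ P) -integral_cst//.
apply: ge0_le_integral => //.
- by move=> t _; apply: gints_ge0 => y; exact: exceeds_ind_ge0.
- have mG := fam_measurable_gints (row0_indices p m)
    (fam_measurable_exceeds N z B v) (fun _ => exceeds_ind_ge0 N z B v).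
  exact: (mG _ T (fun=> tt) (sample X)).
move=> t _; set x := sample X t.
rewrite (_ : exceeds_ind N z B v = fun y =>
    h (cofactor_row0 (B + mx_of_fam y *m N)) (\det (B + mx_of_fam y *m N))); last first.
  by apply/funext => y; rewrite /exceeds_ind solution_exceeds_axis.
rewrite gints_row0//; set C := cofactor_row0 _; set b := (\sum_c _)%R.
(* If [C] vanishes, the strict inequality that defines the event has right-hand side 0 and cannot
   hold. *)
have [C0|C0] := eqVneq (norm2 C) 0%R.
  rewrite (_ : (fun _ => _) = fun=> 0) ?integral0 ?lee_fin//.
  apply/funext => w; rewrite /h C0 mulr0 [(_ * z < 0)%R]ltNge.
  by rewrite mulr_ge0 ?andbF// ltW.
have Cgt0 : (0 < norm2 C)%R by rewrite lt_neqAle eq_sym C0 norm2_ge0.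
have NCgt0 : (0 < norm2 (N *m C))%R.
  rewrite lt_neqAle norm2_ge0 andbT eq_sym; apply: contraTneq (Nk C) => ->.
  by rewrite mulr0 -ltNge.
(* The event forces the determinant into an interval of half-width [e] about 0. Its probability is
   of order [e / norm2 (N *m C)], where the hypothesis [Nk] cancels the norm of [C]. *)
set e := (norm2 v * norm2 C / z)%R.
have e0 : (0 <= e)%R by rewrite divr_ge0 ?mulr_ge0 ?norm2_ge0// ltW.
apply: (@le_trans _ _ (gamma [set w | `|b + norm2 (N *m C) * w| < e]%R)).
  have ml : measurable_fun setT (fun w : R => b + norm2 (N *m C) * w)%R.
    by apply: measurable_funD => //; exact: measurable_funM.
  have mS : measurable_fun setT (fun w : R => `|b + norm2 (N *m C) * w| < e)%R.
    by apply: measurable_fun_ltr => //; exact: measurableT_comp.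
  rewrite -integral_bool_natr//; apply: ge0_le_integral => //.
  - exact: (measurableT_comp (mh C) ml).
  - exact: measurable_bool_natr.
  move=> w _; rewrite /h lee_fin ler_nat /e ltr_pdivlMr//.
  by case: (_ < _)%R; rewrite ?andbF//; case: eqP.
apply: le_trans (std_normal_interval _ NCgt0 e0) _; rewrite lee_fin.
rewrite ler_pdivrMr// /e.
rewrite [leLHS](_ : _ = 2 * normal_peak 1 * norm2 v / z * norm2 C)%R; last by ring.
rewrite [leRHS](_ : _ =
  2 * normal_peak 1 * norm2 v / z * (k * norm2 (N *m C)))%R; last by ring.
by rewrite ler_wpM2l// divr_ge0 ?mulr_ge0 ?normal_peak_ge0 ?norm2_ge0// ltW.
Qed.

End axis.

Section singular.
Context (p m : nat) (X : 'I_p.+1 * 'I_m -> {RV P >-> R}).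
Hypothesis iidX : iid_std_normal X.
Variables (N : 'M[R]_(m, p.+1)).

Lemma std_normal_set1 (a : R) : gamma [set a] = 0.
Proof.
have /null_content_dominatesP := normal_prob_dominates (0 : R) 1.
by apply => //; exact: lebesgue_measure_set1.
Qed.

(** Where [C] is non-zero, injectivity of [N] gives [N C != 0]; the determinant is then
    conditionally a non-degenerate normal variable, which takes the value 0 with probability 0. *)
Lemma integral_singular_cofactor (B : 'M[R]_p.+1) :
  (forall w : 'cV[R]_p.+1, N *m w = 0 -> w = 0)%R ->
  \int[P]_t ((\det (B + mx_of_fam (sample X t) *m N) == 0)%R &&
     (norm2 (cofactor_row0 (B + mx_of_fam (sample X t) *m N)) != 0)%R)%:R%:E
  = 0 :> \bar R.
Proof.
move=> Ninj.
pose h (C : 'cV[R]_p.+1) (w : R) : \bar R := ((w == 0) && (norm2 C != 0))%R%:R%:E.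
pose F (y : 'I_p.+1 * 'I_m -> R) := h (cofactor_row0 (B + mx_of_fam y *m N)%R)
  (\det (B + mx_of_fam y *m N)%R).
have F0 y : 0 <= F y by rewrite lee_fin.
have mF : fam_measurable (fun _ : unit => F).
  move=> d' S tau g _ mg; apply: measurable_bool_natr; apply: measurable_and.
    apply: measurable_fun_eqr => //; apply: measurable_det => i j.
    exact: measurable_affine_mx.
  apply: measurable_neg; apply: measurable_fun_eqr => //; apply: measurable_norm2 => i.
  under eq_fun do rewrite mxE /cofactor.
  apply: measurable_funM => //; apply: measurable_det => a b.
  rewrite (_ : (fun _ => _) = fun s => (B + mx_of_fam (g s) *m N)%R
    (lift ord0 a) (lift i b)); first exact: measurable_affine_mx.
  by apply/funext => s; rewrite mxE [LHS]mxE.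
rewrite -[LHS]/(\int[P]_t F (sample X t)).
rewrite (integral_resamples iidX (row0_indices p m) (F := fun _ : unit => F) tt)//.
rewrite (_ : (fun _ => _) = fun=> 0) ?integral0//; apply/funext => t /=.
have mh C : measurable_fun setT (h C).
  apply: measurable_bool_natr; apply: measurable_and => //.
  exact: measurable_fun_eqr.
have h0 C w : 0 <= h C w by rewrite lee_fin.
rewrite (@gints_row0 _ _ _ N B h (sample X t) mh h0).
set C := cofactor_row0 _; set b := (\sum_c _)%R.
have [C0|C0] := eqVneq (norm2 C) 0%R.
  rewrite (_ : (fun _ => _) = fun=> 0) ?integral0//.
  by apply/funext => w; rewrite /h C0 eqxx andbF.
have NC0 : norm2 (N *m C) != 0%R.
  by apply: contra_neq C0 => /norm2_eq0/Ninj ->; rewrite norm20.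
rewrite integral_bool_natr; last first.
  apply: measurable_and => //; apply: measurable_fun_eqr => //.
  by apply: measurable_funD => //; exact: measurable_funM.
rewrite (_ : [set _ | _] = [set (- b / norm2 (N *m C))%R]).
  exact: std_normal_set1.
apply/seteqP; split => w /=; rewrite C0 andbT.
  by rewrite addrC addr_eq0 => /eqP <-; rewrite mulrC mulKf.
by move=> ->; rewrite mulrC divfK// subrr.
Qed.

End singular.
End anticoncentration.

(** * Almost sure invertibility, and right-hand sides in all directions *)

Section families.
Context d (T : measurableType d) (R : realType) (P : probability T R).
Local Open Scope ereal_scope.

Lemma mutually_independent_inj (I J : finType) (X : I -> {RV P >-> R}) (f : J -> I) :
  injective f -> mutually_independent X -> mutually_independent (X \o f).
Proof.
move=> finj indX K B mB.
(* The sets are carried along [f]; indices outside its image receive no constraint. *)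
pose B' i := if [pick j | f j == i] is Some j then B j else setT.
have B'f j : B' (f j) = B j.
  rewrite /B'; case: pickP => [k /eqP/finj ->//|/(_ j)]; by rewrite eqxx.
have mB' i : measurable (B' i) by rewrite /B'; case: pickP.
have := indX (f @: K)%SET B' mB'.
rewrite big_imset/=; last by move=> ? ? _ _; exact: finj.
under eq_bigr do rewrite B'f.
move=> <-; congr (P _); apply/seteqP; split => t /= Bt.
  by move=> _ /= /imsetP[j jK ->]; rewrite /= B'f; exact: Bt.
by move=> j /= jK; have := Bt (f j); rewrite /= B'f; apply; exact: imset_f.
Qed.

Lemma iid_std_normal_inj (I J : finType) (X : I -> {RV P >-> R}) (f : J -> I) :
  injective f -> iid_std_normal X -> iid_std_normal (X \o f).
Proof.
move=> finj [dX indX]; split; first by move=> j B mB; exact: dX.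
exact: mutually_independent_inj.
Qed.

(** By induction on [p]. A singular matrix either has a non-zero vector of first-row cofactors, a
    null event, or has a zero corner cofactor; the latter is the determinant of a smaller matrix
    [B' + Z' N'] of the same kind. *)
Lemma integral_singular p m (X : 'I_p * 'I_m -> {RV P >-> R}) (N : 'M[R]_(m, p))
    (B : 'M[R]_p) : iid_std_normal X ->
  (forall w : 'cV[R]_p, N *m w = 0 -> w = 0)%R ->
  \int[P]_t (\det (B + mx_of_fam (sample X t) *m N) == 0)%R%:R%:E = 0 :> \bar R.
Proof.
elim: p X N B => [|p IH] X N B iidX Ninj.
  rewrite (_ : (fun _ => _) = fun=> 0) ?integral0//; apply/funext => t.
  by rewrite det_mx00 oner_eq0.
pose f (ik : 'I_p * 'I_m) : 'I_p.+1 * 'I_m := (lift ord0 ik.1, ik.2).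
have finj : injective f by move=> [i k'] [j l] [] /= /addnI/val_inj -> ->.
pose X' := X \o f; pose N' : 'M[R]_(m, p) := col' ord0 N.
pose B' : 'M[R]_p := row' ord0 (col' ord0 B).
have N'inj (w : 'cV[R]_p) : N' *m w = 0%R -> w = 0%R.
  (* Deleting a column of [N] keeps it injective: [w] is padded with a zero in that place. *)
  move=> N'w; pose u : 'cV[R]_p.+1 := \col_i oapp (w^~ 0%R) 0%R (unlift ord0 i).
  have u0 : u = 0%R.
    apply: Ninj; rewrite -N'w; apply/matrixP => a b; rewrite !mxE big_ord_recl.
    rewrite mxE unlift_none/= mulr0 add0r; apply: eq_bigr => j _.
    by rewrite !mxE liftK/= ord1.
  apply/matrixP => i j; have /matrixP/(_ (lift ord0 i) 0%R) := u0.
  by rewrite !mxE liftK/= ord1.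
pose A t := (B + mx_of_fam (sample X t) *m N)%R.
pose A' t := (B' + mx_of_fam (sample X' t) *m N')%R.
have minorE t : row' ord0 (col' ord0 (A t)) = A' t.
  apply/matrixP => a b; rewrite !mxE; congr (_ + _)%R; apply: eq_bigr => k _.
  by rewrite !mxE.
have mdet q (Y : 'I_q * 'I_m -> {RV P >-> R}) (B0 : 'M[R]_q) (N0 : 'M[R]_(m, q)) :
    measurable_fun setT (fun t => \det (B0 + mx_of_fam (sample Y t) *m N0) == 0)%R.
  apply: measurable_fun_eqr => //; apply: measurable_det => i j.
  by apply: measurable_affine_mx => k; exact: (@measurable_funPT _ _ _ _ (Y k)).
have mC : measurable_fun setT (fun t => norm2 (cofactor_row0 (A t)) != 0)%R.
  apply: measurable_neg; apply: measurable_fun_eqr => //; apply: measurable_norm2 => i.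
  under eq_fun do rewrite mxE /cofactor.
  apply: measurable_funM => //; apply: measurable_det => a b.
  rewrite (_ : (fun _ => _) = fun s => A s (lift ord0 a) (lift i b)).
    by apply: measurable_affine_mx => k; exact: (@measurable_funPT _ _ _ _ (X k)).
  by apply/funext => s; rewrite mxE [LHS]mxE.
apply/eqP; rewrite eq_le integral_ge0 ?andbT//.
have <- : \int[P]_t (((\det (A t) == 0)%R && (norm2 (cofactor_row0 (A t)) != 0)%R)%:R%:E
    + (\det (A' t) == 0)%R%:R%:E) = 0 :> \bar R.
  rewrite ge0_integralD//.
  - rewrite (integral_singular_cofactor iidX B Ninj) add0e.
    by apply: IH => //; exact: iid_std_normal_inj.
  - by apply: measurable_bool_natr; apply: measurable_and => //; exact: mdet.
  - by apply: measurable_bool_natr; exact: mdet.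
apply: ge0_le_integral => //.
- by apply: measurable_bool_natr; exact: mdet.
- apply: emeasurable_funD.
    by apply: measurable_bool_natr; apply: measurable_and => //; exact: mdet.
  by apply: measurable_bool_natr; exact: mdet.
move=> t _; rewrite -EFinD lee_fin -natrD ler_nat -/(A t).
case: eqP => //= dA0; case: eqP => //= /norm2_eq0/matrixP/(_ ord0 0%R).
rewrite !mxE /cofactor minorE => /eqP.
by rewrite mulf_eq0 signr_eq0/= => ->.
Qed.

Section all_directions.
Context (p m : nat) (X : 'I_p.+1 * 'I_m -> {RV P >-> R}).
Hypothesis iidX : iid_std_normal X.
Variables (N : 'M[R]_(m, p.+1)) (k : R).
Hypotheses (k_ge0 : (0 <= k)%R) (Nk : forall w, (norm2 w <= k * norm2 (N *m w))%R).

(** Plane rotations move the coordinates of [v] into the first one, starting from the last. The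
    induction is on the largest index [l] at which [v] may be non-zero, and [l = 0] is the axis
    case. *)
Lemma integral_exceeds (z : R) (B : 'M[R]_p.+1) (v : 'cV[R]_p.+1) : (0 < z)%R ->
  \int[P]_t exceeds_ind N z B v (sample X t) <=
    (2 * normal_peak 1 * norm2 v * k / z)%:E.
Proof.
move=> z0.
suff main l : forall B (v : 'cV[R]_p.+1),
    (forall i : 'I_p.+1, (l < i)%N -> v i 0 = 0)%R ->
    \int[P]_t exceeds_ind N z B v (sample X t) <=
      (2 * normal_peak 1 * norm2 v * k / z)%:E.
  by apply: (main p) => i; rewrite ltnNge -ltnS ltn_ord.
elim: l => [|l IH] {}B {}v vl.
  by apply: integral_exceeds_axis => // i i0; rewrite vl// lt0n.
have [pl|lp] := leqP p l.
  by apply: IH => i li; have := leq_ltn_trans pl li; rewrite ltnNge -ltnS ltn_ord.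
pose b : 'I_p.+1 := Ordinal (lp : (l.+1 < p.+1)%N).
have [vb0|vb0] := eqVneq (v b 0%R) 0%R.
  apply: IH => i; rewrite leq_eqVlt => /predU1P[lb|]; last exact: vl.
  by rewrite (_ : i = b)//; apply: val_inj.
pose r := Num.sqrt (v ord0 0%R ^+ 2 + v b 0%R ^+ 2).
have r2 : (r ^+ 2 = v ord0 0%R ^+ 2 + v b 0%R ^+ 2)%R.
  by rewrite sqr_sqrtr// addr_ge0 ?sqr_ge0.
have b2 : (0 < v b 0%R ^+ 2)%R by rewrite exprn_even_gt0.
have rn0 : r != 0%R.
  by rewrite -sqrf_eq0 r2 gt_eqF// ltr_wpDl ?sqr_ge0.
pose c := (v ord0 0 / r)%R; pose s := (v b 0 / r)%R.
have cs : (c ^+ 2 + s ^+ 2 = 1)%R.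
  by rewrite !expr_div_n -mulrDl -r2 divff// expf_neq0.
have s2 : (0 < s ^+ 2)%R by rewrite exprn_even_gt0//= mulf_neq0// invr_neq0.
(* The rotation is admissible because the coordinate to be removed is non-zero, hence so is [s]. *)
have c1 : c != (-1)%R.
  by apply: contraTneq s2 => c1; move: cs; rewrite c1 sqrrN expr1n; lra.
have ab : ord0 != b by [].
rewrite -(integral_exceeds_givens iidX N z B v ab cs c1).
rewrite -(norm2_givens v ab cs); apply: IH => i li.
rewrite givens_mulE; have [i0|i0] := eqVneq i ord0; first by rewrite i0 in li.
have [ib|ib] := eqVneq i b; first by rewrite /c /s; field.
apply: vl; rewrite ltn_neqAle li andbT; apply: contra_neq ib => lb.
by apply: val_inj.
Qed.

End all_directions.
End families.

(** * Averaging over the right-hand side *)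

Section moments.
Context {R : realType}.
Local Notation gamma := (normal_prob (0 : R) 1).
Local Open Scope ereal_scope.

(** Each square integrates to at most 1. In the induction the square of the outermost variable is
    first counted as part of the constant [b]. *)
Lemma gints_le_sum_sqr d (T : measurableType d) (I : eqType) (s : seq I)
    (F : T -> (I -> R) -> \bar R) (t : T) (a b : R) (x : I -> R) : uniq s ->
  (0 <= a)%R -> (0 <= b)%R -> fam_measurable F -> (forall t y, 0 <= F t y) ->
  (forall y, (forall i, i \notin s -> y i = x i) ->
     F t y <= (a * \sum_(i <- s) y i ^+ 2 + b)%:E) ->
  gints s (F t) x <= (a * (size s)%:R + b)%:E.
Proof.
move=> + a0 + mF F0; elim: s b x => [|i s IH] b x /=.
  by move=> _ b0 Fb; have := Fb x (fun _ _ => erefl); rewrite big_nil mulr0.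
move=> /andP[iNs us] b0 Fb.
have sq0 (u : R) : (0 <= a * u ^+ 2)%R by rewrite mulr_ge0// sqr_ge0.
have msq : measurable_fun setT (fun u : R => (u ^+ 2)%:E).
  by apply/measurable_EFinP; exact: measurable_funX.
have c0 : (0 <= a * (size s)%:R + b)%R by rewrite addr_ge0// mulr_ge0.
apply: (@le_trans _ _ (\int[gamma]_u ((a * (size s)%:R + b)%:E + a%:E * (u ^+ 2)%:E))).
  apply: ge0_le_integral => //.
  - by move=> u _; exact: gints_ge0.
  - have mG := fam_measurable_gints s mF F0.
    exact: (fam_measurable_point t x i mG).
  - by apply: emeasurable_funD => //; exact: measurable_funeM.
  move=> u _; rewrite -EFinM -EFinD -addrA; apply: IH => //.
    by rewrite addr_ge0.
  move=> y yx; apply: le_trans (Fb y _) _.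
    move=> l; rewrite in_cons negb_or => /andP[li lNs].
    by rewrite yx// upd_neq.
  rewrite lee_fin big_cons yx// updE mulrDr; lra.
rewrite ge0_integralD//; last 2 first.
- by move=> u _; rewrite -EFinM lee_fin.
- exact: measurable_funeM.
rewrite ge0_integralZl//; last by move=> u _; rewrite lee_fin sqr_ge0.
rewrite std_normal_integral_cst -natr1 mulrDr mulr1 [in leRHS]addrAC [leRHS]EFinD.
apply: leeD => //; rewrite -[leRHS]mule1.
by apply: lee_wpmul2l; [rewrite lee_fin|exact: std_normal_second_moment].
Qed.

End moments.

Section small_singular_value.
Context {R : realType}.

(** With [D] the inner product, the squared norm of [norm2 v ^+ 2 *: u - D *: v] is [norm2 v ^+ 2]
    times the difference of the two squared sides. *)
Lemma cauchy_schwarz p (u v : 'cV[R]_p) : `|(u^T *m v) 0 0| <= norm2 u * norm2 v.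
Proof.
have [->|v0] := eqVneq v 0.
  by rewrite mulmx0 mxE normr0 norm20 mulr0.
have n0 : norm2 v != 0 by apply: contra_neq v0; exact: norm2_eq0.
rewrite -(@ler_pXn2r _ 2)// ?nnegrE ?mulr_ge0 ?norm2_ge0// real_normK ?num_real//.
rewrite exprMn; set D := (u^T *m v) 0 0.
have vgt0 : 0 < norm2 v ^+ 2 by rewrite exprn_even_gt0.
have := sqr_ge0 (norm2 (norm2 v ^+ 2 *: u - D *: v)).
suff -> : norm2 (norm2 v ^+ 2 *: u - D *: v) ^+ 2 =
    norm2 v ^+ 2 * (norm2 u ^+ 2 * norm2 v ^+ 2 - D ^+ 2).
  by rewrite pmulr_rge0// subr_ge0.
have DE : D = \sum_i u i 0 * v i 0 by rewrite /D mxE; apply: eq_bigr => i _; rewrite mxE.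
rewrite [LHS]norm2_sqr.
transitivity (\sum_i ((norm2 v ^+ 2) ^+ 2 * u i 0 ^+ 2 + D ^+ 2 * v i 0 ^+ 2 -
    2 * D * norm2 v ^+ 2 * (u i 0 * v i 0))).
  by apply: eq_bigr => i _; rewrite !mxE; ring.
rewrite big_split/= sumrN big_split/= -!mulr_sumr -DE -!norm2_sqr; ring.
Qed.

Lemma solution_exceeds_of_transpose p (A : 'M[R]_p) (a g : 'cV[R]_p) (y t : R) :
  0 < y -> 0 < t -> A \in unitmx ->
  norm2 (A^T *m a) < y * norm2 a -> t * norm2 a <= `|(g^T *m a) 0 0| ->
  solution_exceeds (t / y) A g.
Proof.
move=> y0 t0 uA Aa ga; rewrite /solution_exceeds uA/= ltr_pdivrMr//.
set w := invmx A *m g.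
have a0 : 0 < norm2 a.
  rewrite lt_neqAle norm2_ge0 andbT eq_sym; apply/negP => /eqP a0.
  by move: Aa; rewrite a0 mulr0 ltNge norm2_ge0.
have gE : (g^T *m a) 0 0 = (w^T *m (A^T *m a)) 0 0.
  by rewrite mulmxA -trmx_mul /w mulKVmx.
have h := le_trans ga (eq_ind_r (fun z => `|z| <= _) (cauchy_schwarz w (A^T *m a)) gE).
have w0 : 0 < norm2 w.
  rewrite lt_neqAle norm2_ge0 andbT eq_sym; apply/negP => /eqP w0.
  by move: h; rewrite w0 mul0r leNgt mulr_gt0.
rewrite -(ltr_pM2r a0) -mulrA; apply: le_lt_trans h _.
by rewrite ltr_pM2l.
Qed.

End small_singular_value.

Section tail_bound.
Context d (T : measurableType d) (R : realType) (P : probability T R).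
Local Notation gamma := (normal_prob (0 : R) 1).
Local Open Scope ereal_scope.
Context (p m : nat) (X : 'I_p.+1 * 'I_m -> {RV P >-> R}).
Hypothesis iidX : iid_std_normal X.
Variables (N : 'M[R]_(m, p.+1)) (k : R).
Hypotheses (k_ge0 : (0 <= k)%R) (Nk : forall w, (norm2 w <= k * norm2 (N *m w))%R).

(** [E] is any measurable subset of the event, so the measurability of a union over all vectors [a]
    does not arise. The averaged right-hand side enters through [gints] only, and Tonelli exchanges
    it with [P]. *)
Lemma probability_small_singular_value (B : 'M[R]_p.+1) (y : R) (E : set T) :
  (0 < y)%R -> measurable E ->
  (forall t, E t -> exists a : 'cV[R]_p.+1,
    norm2 ((B + mx_of_fam (sample X t) *m N)^T *m a) < y * norm2 a)%R ->
  P E <= (235%:R / 100%:R * y * Num.sqrt p.+1%:R * k)%:E.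
Proof.
move=> y0 mE Ea.
pose tau : R := (3 / 4)%R.
have tau0 : (0 < tau)%R by rewrite /tau; lra.
pose z := (tau / y)%R.
have z0 : (0 < z)%R by rewrite divr_gt0.
pose A t := (B + mx_of_fam (sample X t) *m N)%R.
pose s := enum 'I_p.+1.
pose F t (g : 'I_p.+1 -> R) : \bar R :=
  exceeds_ind N z B (\col_i g i) (sample X t).
have F0 t g : 0 <= F t g by exact: exceeds_ind_ge0.
have mX i : measurable_fun setT (X i) by exact: (@measurable_funPT _ _ _ _ (X i)).
have mF : fam_measurable F.
  move=> d' S ta g mta mg; apply: measurable_bool_natr.
  apply: measurable_solution_exceeds.
    move=> i j; apply: (measurable_affine_mx N (g := fun s => sample X (ta s))) => l.
    exact: (measurableT_comp (mX l) mta).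
  by move=> i; under eq_fun do rewrite mxE; exact: mg.
pose q := gamma [set x | tau <= `|x|]%R.
have mq (a : R) : measurable_fun setT (fun x : R => a <= `|x|)%R.
  by apply: measurable_fun_ler => //; exact: measurableT_comp.
have mS : measurable [set x : R | tau <= `|x|]%R.
  by have := mq tau measurableT [set true] Logic.I; rewrite setTI preimage_true.
have q0 : 0 <= q by exact: measure_ge0.
have qfin : q \is a fin_num by exact: fin_num_measure.
have q1 : q <= 1 by exact: probability_le1.
(* At singular outcomes [solution_exceeds] is false; this term makes up for it there and has
   integral 0. *)
pose sing t : \bar R := (\det (A t) == 0)%R%:R%:E.
have msing : measurable_fun setT sing.
  apply: measurable_bool_natr; apply: measurable_fun_eqr => //.
  by apply: measurable_det => i j; exact: measurable_affine_mx.
have mG : measurable_fun setT (fun t => gints s (F t) (fun=> 0%R)).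
  exact: (fam_measurable_gints s mF F0 (tau := id) (g := fun _ _ => 0%R)).
have G0 t : 0 <= gints s (F t) (fun=> 0%R) by exact: gints_ge0.
have Ninj (w : 'cV[R]_p.+1) : N *m w = 0%R -> w = 0%R.
  move=> Nw; apply: norm2_eq0; apply/eqP; rewrite eq_le norm2_ge0 andbT.
  by have := Nk w; rewrite Nw norm20 mulr0.
(* At a given [t] in [E] the vector [a] is fixed and only [g] varies: its inner product with [a] is
   normal of deviation [norm2 a], so it is at least [tau * norm2 a] in absolute value with
   probability exactly [q]. *)
have lower : P E * q <= \int[P]_t (sing t + gints s (F t) (fun=> 0%R)).
  have -> : P E = \int[P]_t (\1_E t)%:E by rewrite integral_indic// setIT.
  rewrite muleC -ge0_integralZl//; last exact/measurable_EFinP/measurable_indic.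
  apply: ge0_le_integral => //.
  - by move=> t _; apply: mule_ge0 => //; rewrite lee_fin.
  - by apply: measurable_funeM; exact/measurable_EFinP/measurable_indic.
  - exact: emeasurable_funD.
  move=> t _; rewrite indicE; case: (boolP (t \in E)) => [|_]; last first.
    by rewrite mule0 adde_ge0// lee_fin.
  rewrite inE mule1 => /Ea[a ha]; rewrite /sing.
  case: eqVneq => [_|dA]; first by apply: le_trans q1 _; rewrite leeDl.
  rewrite add0e.
  have uA : A t \in unitmx by rewrite unitmxE unitfE.
  have a0 : (0 < norm2 a)%R.
    rewrite lt_neqAle norm2_ge0 andbT eq_sym; apply/negP => /eqP a0.
    by move: ha; rewrite a0 mulr0 ltNge norm2_ge0.
  pose h (w : R) : \bar R := (tau * norm2 a <= `|w|)%R%:R%:E.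
  pose K (_ : unit) (g : 'I_p.+1 -> R) : \bar R := h (\sum_(i <- s) a i 0 * g i)%R.
  have mh : measurable_fun setT h by apply: measurable_bool_natr; exact: mq.
  have mK : fam_measurable K.
    move=> d' S ta g _ mg; apply: (measurableT_comp mh).
    by apply: measurable_sum => i; exact: measurable_funM.
  have -> : q = gints s (K tt) (fun=> 0%R).
    rewrite (@gints_linear _ _ s (fun i => a i 0%R) _ h 0%R (fun=> 0%R))//; last 3 first.
    - exact: enum_uniq.
    - by move=> w; rewrite lee_fin.
    - by move=> g _; rewrite add0r.
    rewrite integral_bool_natr; last first.
      apply: measurable_fun_ler => //; apply: measurableT_comp => //.
      by apply: measurable_funD => //; exact: measurable_funM.
    congr (gamma _); apply/seteqP.
    have -> : Num.sqrt (\sum_(i <- s) a i 0 ^+ 2)%R = norm2 a by rewrite big_enum.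
    by split => w /=; rewrite add0r normrM ger0_norm ?norm2_ge0// mulrC ler_pM2l.
  apply: (@le_gints _ _ _ _ s (fun _ : unit => K tt) (fun _ => F t) tt) => //.
  - by move=> d' S ta g _ mg; apply: (mF _ S (fun=> t) g).
  - by move=> _ g; rewrite lee_fin.
  move=> g; rewrite /K /h /F /exceeds_ind lee_fin ler_nat.
  case: (boolP (_ <= `| _ |)%R) => //= hg; rewrite lt0b.
  apply: (solution_exceeds_of_transpose (a := a)) => //.
  apply: le_trans hg _; rewrite le_eqVlt; apply/orP; left; apply/eqP; congr `| _ |%R.
  by rewrite big_enum mxE; apply: eq_bigr => i _; rewrite !mxE mulrC.
pose C := (2 * normal_peak 1 * k / z)%R.
have C0 : (0 <= C)%R.
  by apply: divr_ge0; [rewrite !mulr_ge0 ?normal_peak_ge0|exact: ltW].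
set sq := Num.sqrt p.+1%:R.
have sp : (0 < sq)%R by rewrite sqrtr_gt0.
have sq2 : (sq ^+ 2 = p.+1%:R)%R by rewrite sqr_sqrtr.
clearbody sq.
have upper : \int[P]_t (sing t + gints s (F t) (fun=> 0%R)) <= (C * sq)%:E.
  rewrite ge0_integralD//; last by move=> t _; rewrite lee_fin.
  rewrite integral_singular// add0e integral_gints//.
  (* The norm is bounded by [norm2 v ^+ 2 / (2 * sq) + sq / 2], since [(norm2 v - sq) ^+ 2 >= 0].
     The second moment then suffices, and the two halves add up to [sq]. *)
  rewrite [leRHS](_ : _ = (C / (2 * sq) * (size s)%:R +
      C * sq / 2)%:E); last first.
    rewrite size_enum_ord; congr (_%:E).
    by rewrite -sq2; field; rewrite gt_eqF.
  apply: (@gints_le_sum_sqr R _ unit _ s (fun _ g => \int[P]_t F t g) tt).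
  - exact: enum_uniq.
  - by rewrite divr_ge0// mulr_ge0// ltW.
  - by rewrite divr_ge0// mulr_ge0// ltW.
  - move=> d' S ta g _ mg.
    pose f (st : S * T) := F st.2 (g st.1).
    apply: (@measurable_fun_fubini_tonelli_F _ _ S T R P f) => [|st]; last exact: F0.
    by apply: mF => // i; exact: (measurableT_comp (mg i) measurable_fst).
  - by move=> _ g; exact: integral_ge0.
  move=> g _; apply: le_trans (integral_exceeds iidX k_ge0 Nk B _ z0) _.
  rewrite lee_fin; set v : 'cV[R]_p.+1 := \col_i g i.
  have -> : (\sum_(i <- s) g i ^+ 2 = norm2 v ^+ 2)%R.
    by rewrite norm2_sqr big_enum; apply: eq_bigr => i _; rewrite mxE.
  rewrite [leLHS](_ : _ = C * norm2 v)%R; last by rewrite /C; ring.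
  rewrite -subr_ge0 [leRHS](_ : _ =
    C / (2 * sq) * (norm2 v - sq) ^+ 2)%R.
    by rewrite mulr_ge0 ?sqr_ge0// divr_ge0// mulr_ge0// ltW.
  by field; rewrite gt_eqF.
have := le_trans lower upper; have := @std_normal_tail_ge R.
have PEfin : P E \is a fin_num by exact: fin_num_measure.
rewrite -/q -(fineK qfin) -(fineK PEfin) -!EFinM !lee_fin.
set e := fine (P E); set f := fine q => tail bound.
have pk : (0 < 2 * normal_peak 1 :> R)%R by rewrite mulr_gt0// normal_peak_gt0// oner_neq0.
have f0 : (0 < f)%R.
  rewrite -(pmulr_rgt0 _ (_ : 0 < 235%:R / 100%:R * (3 / 4) :> R)%R); last lra.
  exact: lt_le_trans tail.
(* In the bound [C * sq] the numerical inequality [tail] replaces [2 * normal_peak 1] by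
   [2.35 * tau * f], and [tau] cancels. *)
rewrite -(ler_pM2r f0); apply: le_trans bound _.
rewrite [leLHS](_ : _ = 2 * normal_peak 1 * (k * y / tau * sq))%R; last first.
  by rewrite /C /z; field; rewrite !gt_eqF.
have ky : (0 <= k * y / tau * sq)%R.
  by rewrite !mulr_ge0 ?invr_ge0// ltW.
apply: le_trans (ler_wpM2r ky tail) _.
rewrite le_eqVlt; apply/orP; left; apply/eqP.
by rewrite /tau; field.
Qed.

End tail_bound.

(** * Pseudo-inverses and Gaussian matrices *)

Section linear_algebra.
Context {R : realType}.

(** The square of [norm2 (A^T *m x)] is the inner product of [x] with [A *m (A^T *m x)];
    Cauchy-Schwarz bounds it and one factor cancels. *)
Lemma spectral_norm_tr_le p r (A : 'M[R]_(p, r)) :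
  spectral_norm A^T <= spectral_norm A.
Proof.
apply/(spectral_norm_le _ (spectral_norm_ge0 A)) => x.
have [->|y0] := eqVneq (norm2 (A^T *m x)) 0.
  by rewrite mulr_ge0 ?spectral_norm_ge0 ?norm2_ge0.
have y1 : 0 < norm2 (A^T *m x) by rewrite lt_neqAle eq_sym y0 norm2_ge0.
rewrite -(ler_pM2r y1) -expr2 norm2_sqrE trmx_mul trmxK -mulmxA.
apply: le_trans (ler_norm _) _; apply: le_trans (cauchy_schwarz _ _) _.
rewrite mulrC mulrAC ler_wpM2r ?norm2_ge0//.
exact: (spectral_norm_le _ (spectral_norm_ge0 A)).1.
Qed.

Lemma spectral_norm_tr p r (A : 'M[R]_(p, r)) : spectral_norm A^T = spectral_norm A.
Proof.
apply/eqP; rewrite eq_le spectral_norm_tr_le -{1}[A]trmxK.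
exact: spectral_norm_tr_le.
Qed.

Lemma mpinv_tr p r (A : 'M[R]_(p, r)) : mpinv A^T = (mpinv A)^T.
Proof.
apply: (is_mpinv_unique (mpinvP _)); case: (mpinvP A) => AXA XAX AX XA.
split; rewrite -?trmx_mul; first by rewrite mulmxA AXA.
- by rewrite mulmxA XAX.
- by rewrite XA.
- by rewrite AX.
Qed.

(** With full column rank the pseudo-inverse is a left inverse. *)
Lemma norm2_le_mpinv m p (N : 'M[R]_(m, p)) (w : 'cV[R]_p) : \rank N = p ->
  norm2 w <= spectral_norm (mpinv N) * norm2 (N *m w).
Proof.
move=> rN; have [NXN _ _ _] := mpinvP N.
have /row_fullP[C CN] : row_full N by rewrite /row_full rN.
have XN : mpinv N *m N = 1%:M by rewrite -[LHS]mul1mx -CN -!mulmxA [N *m _]mulmxA NXN CN.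
rewrite -{1}[w]mul1mx -XN -mulmxA.
exact: (spectral_norm_le _ (spectral_norm_ge0 (mpinv N))).1.
Qed.

(** By contraposition: if [A^T] expands every vector by at least [y'], the pseudo-inverse has norm
    at most [1 / y']. Singular matrices are thereby included. *)
Lemma small_inv_norm_mpinv p (A : 'M[R]_p.+1) (y y' : R) : 0 < y' ->
  1 / spectral_norm (mpinv A) <= y -> y < y' ->
  exists a : 'cV[R]_p.+1, norm2 (A^T *m a) < y' * norm2 a.
Proof.
move=> y'0 Ay yy'; apply: contrapT => /forallNP h.
have {}h a : y' * norm2 a <= norm2 (A^T *m a) by rewrite leNgt; apply/negP/h.
have iy0 : 0 <= y'^-1 by rewrite invr_ge0 ltW.
have le1 : spectral_norm (mpinv A) <= y'^-1.
  apply/(spectral_norm_pinv_le _ iy0) => x.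
  have [->|b0] := eqVneq (norm2 (A^T *m x)) 0.
    by rewrite mulr_ge0 ?norm2_ge0.
  have b1 : 0 < norm2 (A^T *m x) by rewrite lt_neqAle eq_sym b0 norm2_ge0.
  rewrite -(ler_pM2r b1) -expr2 norm2_sqrE {1}trmx_mul trmxK -[_ *m A *m _]mulmxA.
  apply: le_trans (ler_norm _) _; apply: le_trans (cauchy_schwarz _ _) _.
  by rewrite [leRHS]mulrAC ler_wpM2r ?norm2_ge0// ler_pdivlMl.
(* Rules out the convention [1 / 0 = 0]; any non-zero vector would serve as a witness. *)
have gt0 : 0 < spectral_norm (mpinv A).
  rewrite ltNge; apply/negP => /(spectral_norm_pinv_le _ (lexx 0)) /(_ (const_mx 1)).
  rewrite mul0r => le0; have := le_trans (h _) le0; rewrite pmulr_rle0//.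
  rewrite leNgt lt_neqAle norm2_ge0 andbT eq_sym => /negP; apply; apply/eqP.
  move=> /norm2_eq0/matrixP/(_ ord0 ord0); rewrite !mxE => /eqP.
  by rewrite oner_eq0.
have : y' <= 1 / spectral_norm (mpinv A).
  by rewrite div1r -[y']invrK lef_pV2// ?posrE ?invr_gt0.
by rewrite leNgt (le_lt_trans Ay).
Qed.

(** Only the first [j] rows of the random factor and the columns of [M_j] enter the block, which
    brings it to the form [Z N]. *)
Lemma lead_block_mulmx j q m n (jq : (j <= q)%N) (jn : (j <= n)%N)
    (W : 'M[R]_(q, m)) (M : 'M[R]_(m, n)) :
  lead_block jq jn (W *m M) = rowsub (widen_ord jq) W *m first_cols j M.
Proof.
apply/matrixP => a b; rewrite !mxE; apply: eq_bigr => k _; rewrite !mxE.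
congr (_ * _); rewrite (bigD1 (widen_ord jn b))//= !mxE/= eqxx ltn_ord mulr1.
rewrite big1 ?addr0// => l lb; rewrite !mxE; case: eqP => [lb'|_]; last by rewrite mulr0.
by case/eqP: lb; apply: val_inj.
Qed.

Lemma lead_block_tr (k p r : nat) (hp : (k <= p)%N) (hr : (k <= r)%N) (A : 'M[R]_(p, r)) :
  (lead_block hp hr A)^T = lead_block hr hp A^T.
Proof. by apply/matrixP => i j; rewrite !mxE. Qed.

Lemma first_rows_tr k p r (A : 'M[R]_(p, r)) : (first_rows k A)^T = first_cols k A^T.
Proof. by rewrite /first_rows trmx_mul tr_pid_mx. Qed.

(** A right inverse [C0] of the row base turns [M] into its column base, which is injective; its
    first [q] columns are kept. *)
Lemma exists_injective_mulmx m n q (M : 'M[R]_(m, n)) : (q <= \rank M)%N ->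
  exists C : 'M[R]_(n, q), forall w : 'cV[R]_q, M *m C *m w = 0 -> w = 0.
Proof.
move=> qM; have /row_freeP[C0 C0E] := row_base_free M.
have /row_fullP[D DE] := col_base_full M.
exists (C0 *m pid_mx q) => w Mw.
have MC : M *m C0 = col_base M.
  have := congr1 (mulmx^~ C0) (mulmx_base M).
  by rewrite -mulmxA C0E mulmx1.
have : pid_mx q *m w = 0 :> 'cV_(\rank M).
  have := congr1 (mulmx D) Mw.
  move: (col_base M) DE MC => K DE MC.
  by rewrite mulmx0 [M *m _]mulmxA MC !mulmxA DE mul1mx.
move=> /(congr1 (mulmx (@pid_mx R q (\rank M) q))).
by rewrite mulmxA mul_pid_mx mulmx0 minnn (minn_idPr qM) pid_mx_1 mul1mx.
Qed.

End linear_algebra.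

(** * Standardization, full rank and the tail bound *)

Section iid_normal.
Context d (T : measurableType d) (R : realType) (P : probability T R).
Local Open Scope ereal_scope.

Definition iid_normal (mu sigma : R) (I : finType) (X : I -> {RV P >-> R}) : Prop :=
  (forall i (B : set R), measurable B -> distribution P (X i) B = normal_prob mu sigma B) /\
  mutually_independent X.

Lemma iid_normal_inj mu sigma (I J : finType) (X : I -> {RV P >-> R}) (f : J -> I) :
  injective f -> iid_normal mu sigma X -> iid_normal mu sigma (X \o f).
Proof.
move=> finj [dX indX]; split; first by move=> j B mB; exact: dX.
exact: mutually_independent_inj.
Qed.

Lemma iid_normal_standardize mu sigma (I : finType) (X : I -> {RV P >-> R}) :
  (0 < sigma)%R -> iid_normal mu sigma X ->
  exists2 Z : I -> {RV P >-> R}, iid_std_normal Z &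
    forall i t, X i t = (mu + sigma * Z i t)%R.
Proof.
move=> s0 [dX indX].
have mst : measurable_fun setT (fun x : R => (x - mu) / sigma)%R.
  by apply: measurable_funM => //; exact: measurable_funB.
have mZ i : measurable_fun setT (fun t => (X i t - mu) / sigma)%R.
  exact: (measurableT_comp mst (@measurable_funPT _ _ _ _ (X i))).
pose Zm i := isMeasurableFun.Build _ _ _ _ _ (mZ i).
pose Z i : {RV P >-> R} := HB.pack (fun t => (X i t - mu) / sigma)%R (Zm i).
have mpre (B : set R) : measurable B ->
    measurable ((fun x : R => (x - mu) / sigma)%R @^-1` B).
  by move=> mB; rewrite -[X in measurable X]setTI; exact: mst.
exists Z; last by move=> i t; rewrite /Z/=; field; rewrite gt_eqF.
split=> [i B mB|J B mB].
  by rewrite -(normal_prob_standardize mu s0 mB) -(dX i)//; exact: mpre.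
exact: (indX J (fun i => (fun x : R => (x - mu) / sigma)%R @^-1` B i)
  (fun i => mpre _ (mB i))).
Qed.

Section affine.
Context (p m : nat) (mu sigma : R) (X : 'I_p * 'I_m -> {RV P >-> R}).
Hypotheses (sigma_gt0 : (0 < sigma)%R) (iidX : iid_normal mu sigma X).

(** The mean goes into the deterministic term and the deviation into [N]; one [Z] serves all [N]. *)
Lemma sample_affine : exists2 Z : 'I_p * 'I_m -> {RV P >-> R}, iid_std_normal Z &
  forall n (N : 'M[R]_(m, n)) t, mx_of_fam (sample X t) *m N =
    (const_mx mu *m N + mx_of_fam (sample Z t) *m (sigma *: N))%R.
Proof.
have [Z iidZ XZ] := iid_normal_standardize sigma_gt0 iidX; exists Z => // n N t.
rewrite -scalemxAr scalemxAl -mulmxDl; congr (_ *m _).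
by apply/matrixP => i j; rewrite !mxE /sample XZ.
Qed.

End affine.

Lemma ae_det_neq0 (p m : nat) (mu sigma : R) (X : 'I_p * 'I_m -> {RV P >-> R})
    (N : 'M[R]_(m, p)) : (0 < sigma)%R -> iid_normal mu sigma X ->
  (forall w : 'cV[R]_p, N *m w = 0 -> w = 0)%R ->
  {ae P, forall t, \det (mx_of_fam (sample X t) *m N) != 0%R}.
Proof.
move=> s0 iidX Ninj; have [Z iidZ XZ] := sample_affine s0 iidX.
have sNinj (w : 'cV[R]_p) : (sigma *: N *m w = 0 -> w = 0)%R.
  rewrite -scalemxAl => /eqP; rewrite scaler_eq0 gt_eqF//= => /eqP.
  exact: Ninj.
have := integral_singular (const_mx mu *m N)%R iidZ sNinj.
have md : measurable_fun setT (fun t =>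
    \det (const_mx mu *m N + mx_of_fam (sample Z t) *m (sigma *: N)) == 0)%R.
  apply: measurable_fun_eqr => //; apply: measurable_det => i j.
  by apply: measurable_affine_mx => k; exact: (@measurable_funPT _ _ _ _ (Z k)).
rewrite integral_bool_natr// => P0.
exists [set t | \det (const_mx mu *m N + mx_of_fam (sample Z t) *m (sigma *: N)) == 0]%R.
split => //.
  by have := md measurableT [set true] Logic.I; rewrite setTI preimage_true.
by move=> t /=; rewrite XZ => /negP; rewrite negbK.
Qed.

(** Multiplying by a suitable fixed [C] makes the product square and almost surely invertible, and a
    right factor cannot raise the rank. *)
Lemma ae_full_rank (q m n : nat) (mu sigma : R) (X : 'I_q * 'I_m -> {RV P >-> R})
    (M : 'M[R]_(m, n)) : (0 < sigma)%R -> iid_normal mu sigma X ->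
  (q <= \rank M)%N ->
  {ae P, forall t, full_rank (mx_of_fam (sample X t) *m M)}.
Proof.
move=> s0 iidX qM; have [C Cinj] := exists_injective_mulmx qM.
have := ae_det_neq0 s0 iidX Cinj; apply: filterS => t /= d0.
rewrite /full_rank (minn_idPl (leq_trans qM (rank_leq_col M))).
apply/eqP; rewrite eqn_leq rank_leq_row/=.
have : mx_of_fam (sample X t) *m (M *m C) \in unitmx by rewrite unitmxE unitfE.
rewrite -row_free_unit => /eqP {1}<-.
by rewrite mulmxA mxrankM_maxl.
Qed.

Lemma inv_norm_mpinv_tail (j q m n : nat) (mu sigma : R) (jq : (j <= q)%N)
    (jn : (j <= n)%N) (X : 'I_q * 'I_m -> {RV P >-> R}) (M : 'M[R]_(m, n)) (y : R) :
  (0 < j)%N -> (0 < sigma)%R -> (0 <= y)%R -> iid_normal mu sigma X ->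
  \rank (first_cols j M) = j ->
  measurable [set t | 1 / spectral_norm (mpinv
    (lead_block jq jn (mx_of_fam (sample X t) *m M))) <= y]%R ->
  P [set t | 1 / spectral_norm (mpinv
    (lead_block jq jn (mx_of_fam (sample X t) *m M))) <= y]%R <=
  (235%:R / 100%:R * y * Num.sqrt j%:R *
     spectral_norm (mpinv (first_cols j M)) / sigma)%:E.
Proof.
case: j jq jn => // j jq jn _ s0 y0 iidX rM.
set E := [set t | _ <= y]%R; set N := first_cols j.+1 M in rM * => mE.
pose f (ik : 'I_j.+1 * 'I_m) : 'I_q * 'I_m := (widen_ord jq ik.1, ik.2).
have finj : injective f by move=> [i l] [i' l'] [] /= /val_inj -> ->.
have iidX' : iid_normal mu sigma (X \o f) by exact: iid_normal_inj.
have [Z iidZ XZ] := sample_affine s0 iidX'.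
have ZE t : lead_block jq jn (mx_of_fam (sample X t) *m M) =
    (const_mx mu *m N + mx_of_fam (sample Z t) *m (sigma *: N))%R.
  rewrite lead_block_mulmx -XZ; congr (_ *m _).
  by apply/matrixP => a b; rewrite !mxE.
pose k := (spectral_norm (mpinv N) / sigma)%R.
have k0 : (0 <= k)%R by rewrite divr_ge0 ?spectral_norm_ge0// ltW.
have Nk (w : 'cV[R]_j.+1) : (norm2 w <= k * norm2 (sigma *: N *m w))%R.
  rewrite -scalemxAl norm2Z gtr0_norm// mulrA divfK ?gt_eqF//.
  exact: norm2_le_mpinv.
pose c := (235%:R / 100%:R * Num.sqrt j.+1%:R * k)%R.
have c0 : (0 <= c)%R.
  by apply: (mulr_ge0 _ k0); apply: (mulr_ge0 _ (sqrtr_ge0 _)); lra.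
rewrite [leRHS](_ : _ = (c * y)%:E); last by congr EFin; rewrite /c /k; ring.
apply/lee_addgt0Pr => e e0.
(* The estimate requires a positive level and a strict inequality, so it is used at [y' > y]; the
   excess [e * (c / (c + 1))] stays below [e]. The added 1 keeps the denominator positive whatever
   [c >= 0] is. *)
pose y' := (y + e / (c + 1))%R.
have yy' : (y < y')%R by rewrite ltrDl divr_gt0// ltr_wpDl.
have y'0 : (0 < y')%R by exact: le_lt_trans yy'.
apply: (@le_trans _ _ (235%:R / 100%:R * y' * Num.sqrt j.+1%:R * k)%:E).
  have Ea t : E t -> exists a : 'cV[R]_j.+1, (norm2 ((const_mx mu *m N +
      mx_of_fam (sample Z t) *m (sigma *: N))^T *m a) < y' * norm2 a)%R.
    by move=> Et; rewrite -ZE; exact: small_inv_norm_mpinv Et yy'.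
  exact (probability_small_singular_value iidZ k0 Nk y'0 mE Ea).
rewrite lee_fin [leLHS](_ : _ = c * y + e * (c / (c + 1)))%R; last first.
  by rewrite /c /y'; ring.
have c10 : (0 < c + 1)%R by rewrite ltr_wpDl.
rewrite lerD2l; apply: ler_piMr; first exact: ltW.
by rewrite ler_pdivrMr// mul1r lerDl.
Qed.

End iid_normal.

Section gaussian.
Context d (T : measurableType d) (R : realType) (P : probability T R).

Lemma gaussian_matrix_iid p m mu sigma (G : 'M[{RV P >-> R}]_(p, m)) :
  gaussian_matrix mu sigma G ->
  iid_normal mu sigma (fun ij : 'I_p * 'I_m => G ij.1 ij.2).
Proof. by move=> [dG indG]; split => // -[i j] B mB; exact: dG. Qed.

Lemma gaussian_matrix_tr p m mu sigma (G : 'M[{RV P >-> R}]_(p, m)) :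
  gaussian_matrix mu sigma G -> gaussian_matrix mu sigma G^T.
Proof.
move=> gG; have /= sw : injective (fun ij : 'I_m * 'I_p => (ij.2, ij.1)).
  by move=> [? ?] [? ?] [-> ->].
have [dG indG] := iid_normal_inj sw (gaussian_matrix_iid gG).
have GT : (fun ij : 'I_m * 'I_p => G^T ij.1 ij.2) =
    (fun ij => G ij.1 ij.2) \o (fun ij : 'I_m * 'I_p => (ij.2, ij.1)).
  by apply/funext => ij; rewrite mxE.
split; last by rewrite GT.
by move=> i j; rewrite mxE; exact: (dG (i, j)).
Qed.

Lemma outcome_fam p m (G : 'M[{RV P >-> R}]_(p, m)) t :
  outcome G t = mx_of_fam (sample (fun ij : 'I_p * 'I_m => G ij.1 ij.2) t).
Proof. by apply/matrixP => i j; rewrite !mxE. Qed.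

Lemma outcome_tr p m (G : 'M[{RV P >-> R}]_(p, m)) t :
  outcome G^T t = (outcome G t)^T.
Proof. by apply/matrixP => i j; rewrite !mxE. Qed.

Lemma gaussian_matrix_ae_full_rank q m n mu sigma (G : 'M[{RV P >-> R}]_(q, m))
    (M : 'M[R]_(m, n)) : 0 < sigma -> gaussian_matrix mu sigma G ->
  (q <= \rank M)%N -> {ae P, forall t, full_rank (outcome G t *m M)}.
Proof.
move=> s0 gG qM; have := ae_full_rank s0 (gaussian_matrix_iid gG) qM.
by apply: filterS => t; rewrite -outcome_fam.
Qed.

Lemma gaussian_matrix_tail j q m n mu sigma (jq : (j <= q)%N) (jn : (j <= n)%N)
    (G : 'M[{RV P >-> R}]_(q, m)) (M : 'M[R]_(m, n)) y (X : {RV P >-> R}) :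
  (0 < j)%N -> 0 < sigma -> 0 <= y -> gaussian_matrix mu sigma G ->
  \rank (first_cols j M) = j ->
  (forall t, X t = 1 / spectral_norm (mpinv (lead_block jq jn (outcome G t *m M)))) ->
  (cdf X y <= (235%:R / 100%:R * y * Num.sqrt j%:R *
     spectral_norm (mpinv (first_cols j M)) / sigma)%:E)%E.
Proof.
move=> j0 s0 y0 gG rM XE.
have EE : X @^-1` `]-oo, y] = [set t | 1 / spectral_norm (mpinv (lead_block jq jn
    (mx_of_fam (sample (fun ij : 'I_q * 'I_m => G ij.1 ij.2) t) *m M))) <= y].
  by apply/seteqP; split => t /=; rewrite in_itv/= XE outcome_fam.
rewrite /cdf /distribution /pushforward EE.
apply: (inv_norm_mpinv_tail j0 s0 y0 (gaussian_matrix_iid gG) rM).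
by rewrite -EE; exact: measurable_RV_preimage.
Qed.

End gaussian.

Theorem corollary4p1 (R : realType) (d : measure_display)
    (T : measurableType d) (P : probability T R)
    (j k m n q s : nat)
    (j1 : (1 <= j)%N) (jq : (j <= q)%N) (jn : (j <= n)%N)
    (k1 : (1 <= k)%N) (ks : (k <= s)%N) (km : (k <= m)%N)
    (M : 'M[R]_(m, n)) (mu sigma y : R)
    (sigma_gt0 : 0 < sigma) (y_ge0 : 0 <= y)
    (G : 'M[{RV P >-> R}]_(q, m)) (H : 'M[{RV P >-> R}]_(n, s))
    (gaussG : gaussian_matrix mu sigma G)
    (gaussH : gaussian_matrix mu sigma H)
    (rankMj : \rank (first_cols j M) = j)
    (rankMk : \rank (first_rows k M) = k) :
  (((q <= \rank M)%N ->
      {ae P, forall t, full_rank (outcome G t *m M)}) /\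
   ((s <= \rank M)%N ->
      {ae P, forall t, full_rank (M *m outcome H t)})) /\
  (((j <= \rank M)%N ->
      (cdf (inv_norm_pinv (lead_block jq jn (G *m fixed_mx T M))
              : {RV P >-> R}) y
       <= (235%:R / 100%:R * y * Num.sqrt j%:R *
             spectral_norm (mpinv (first_cols j M)) / sigma)%:E)%E) /\
   ((k <= \rank M)%N ->
      (cdf (inv_norm_pinv (lead_block km ks (fixed_mx T M *m H))
              : {RV P >-> R}) y
       <= (235%:R / 100%:R * y * Num.sqrt k%:R *
             spectral_norm (mpinv (first_rows k M)) / sigma)%:E)%E)).
Proof.
have gaussHT := gaussian_matrix_tr gaussH.
split; split.
- by move=> qM; exact: gaussian_matrix_ae_full_rank gaussG qM.
- rewrite -mxrank_tr => sM.
  have := gaussian_matrix_ae_full_rank sigma_gt0 gaussHT sM.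
  apply: filterS => t; rewrite /full_rank outcome_tr -trmx_mul mxrank_tr => ->.
  exact: minnC.
- move=> _.
  apply: (gaussian_matrix_tail (jq := jq) (jn := jn) j1 sigma_gt0 y_ge0 gaussG rankMj).
  by move=> t; rewrite /= /inv_norm_pinv outcome_lead_block outcome_mulmx outcome_fixed_mx.
(* The case of [H^T *m M^T]: leading blocks and pseudo-inverses commute with transposition, and the
   spectral norm is unchanged. *)
- move=> _; rewrite -spectral_norm_tr -mpinv_tr first_rows_tr.
  have rMk : \rank (first_cols k M^T) = k by rewrite -first_rows_tr mxrank_tr.
  apply: (gaussian_matrix_tail (jq := ks) (jn := km) k1 sigma_gt0 y_ge0 gaussHT rMk).
  move=> t; rewrite /= /inv_norm_pinv outcome_lead_block outcome_mulmx outcome_fixed_mx.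
  by rewrite -spectral_norm_tr -mpinv_tr lead_block_tr trmx_mul outcome_tr.
Qed.
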